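(* Let $\lambda\ge\omega$ and $\kappa\ge 2$ be cardinals with $\kappa\lambda>\omega$. (a) If $\mathrm{cf}(\lambda)=\omega_1$, or if $\mathfrak h=\omega_1$ and $\omega_1\le\mathrm{cf}(\lambda)\le\mathfrak c$, then $\mathrm{ro}(\mathrm{rp}^n(\mathrm{Col}(\lambda,\kappa)))\cong\mathrm{Col}(\omega_1,\kappa^{<\lambda})$ for all $n\in\mathbb N$. (b) If $\mathfrak h=\omega_1$ and $\kappa\le\mathfrak c$, then for all $n\in\mathbb N$ $$\mathrm{ro}(\mathrm{rp}^n(\mathrm{Col}(\omega_1,\kappa)))\cong\mathrm{Col}(\omega_1,\mathfrak c)\cong\mathrm{ro}(P(\omega)/\mathrm{Fin})\cong\mathrm{ro}(\mathrm{rp}^n(P(\omega)/\mathrm{Fin})).$$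
   Context: For a Boolean algebra $\mathbb B$, $\mathrm{ro}(\mathbb B)$ is its Boolean completion (the complete Boolean algebra in which $\mathbb B\setminus\{0\}$ is dense). $\mathrm{rp}(\mathbb B)$ is the reduced power $\mathbb B^\omega/\Phi$, where $\Phi$ is the Fréchet filter (cofinite subsets of $\omega$): sequences are identified if they agree on a cofinite set, and $[b]\le[c]$ iff $\{i: b_i\le c_i\}\in\Phi$. Iterates: $\mathrm{rp}^0(\mathbb B)=\mathbb B$, $\mathrm{rp}^{n+1}(\mathbb B)=\mathrm{rp}(\mathrm{rp}^n(\mathbb B))$. $\mathbb N=\{1,2,\dots\}$. For cardinals $\lambda\ge\omega$, $\kappa\ge2$, ${}^{<\lambda}\kappa=\bigcup_{\alpha<\lambda}{}^{\alpha}\kappa$ ($\alpha$ ranging over ordinals), and the collapsing algebra $\mathrm{Col}(\lambda,\kappa)$ is the Boolean completion of the reversed tree $\langle{}^{<\lambda}\kappa,\supseteq\rangle$ (longer functions are stronger). $\kappa^{<\lambda}=|{}^{<\lambda}\kappa|=\sup\{\kappa^\nu:\nu<\lambda\}$. $\mathfrak c=2^\omega$; $\mathfrak h$ is the distributivity number of $(P(\omega)/\mathrm{Fin})\setminus\{0\}$ (least size of a family of dense open subsets with non-dense intersection), $\mathrm{Fin}$ being the ideal of finite subsets of $\omega$. *)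

(* Defs.v *)
From HB Require Import structures.
From mathcomp Require Import all_boot all_order.
From mathcomp Require Import generic_quotient.
From mathcomp Require Import boolp classical_sets functions cardinality filter.
From mathcomp Require wochoice.

Set Implicit Arguments.
Unset Strict Implicit.
Unset Printing Implicit Defensive.

Import Order.Theory.

Local Open Scope classical_set_scope.
Local Open Scope card_scope.
Local Open Scope order_scope.
Local Open Scope quotient_scope.

(** Boolean algebras are [ctbDistrLatticeType]s; they are isomorphic when they
    are isomorphic as partial orders. *)
Definition ba_iso d1 d2 (A : ctbDistrLatticeType d1)
    (B : ctbDistrLatticeType d2) : Prop :=
  exists2 f : A -> B, bijective f & {mono f : x y / x <= y}.

Fact forcing_display : Order.disp_t. Proof. exact: Order.Disp tt tt. Qed.

Notation "A '≅' B" := (ba_iso A B) (at level 70, no associativity).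

Section RegularOpen.
Context {d : Order.disp_t} (P : porderType d).
Implicit Types (A B : set P) (p q : P).

Definition perp A : set P := [set p | forall q, q <= p -> ~ A q].

(** The regular open sets of the topology on [P] whose open sets are the
    downward closed sets: [perp A] is the interior of the complement of [A],
    and [perp (perp A)] the interior of the closure when [A] is open. *)
Record regular_open := RegularOpen {
  ro_set :> set P;
  _ : perp (perp ro_set) == ro_set }.

HB.instance Definition _ := [isSub for ro_set].
HB.instance Definition _ := [Choice of regular_open by <:].

Lemma ro_inj (U V : regular_open) : (U : set P) = V -> U = V.
Proof. exact: val_inj. Qed.

Lemma perp_perp (U : regular_open) : perp (perp U) = U.
Proof. by case: U => A /= /eqP. Qed.

Lemma perpS A B : A `<=` B -> perp B `<=` perp A.
Proof. by move=> AB p Bp q qp /AB; apply: Bp. Qed.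

Lemma perp_down A p q : q <= p -> perp A p -> perp A q.
Proof. by move=> qp Ap r rq; apply: Ap (le_trans rq qp). Qed.

Lemma ro_down (U : regular_open) p q : q <= p -> (U : set P) p -> (U : set P) q.
Proof. by rewrite -(perp_perp U); apply: perp_down. Qed.

Lemma perp3 A : (forall p q, q <= p -> A p -> A q) ->
  perp (perp (perp A)) = perp A.
Proof.
move=> Ad; apply/seteqP; split=> p Ap q qp.
  by move=> Aq; apply: (Ap q qp) => r rq nr; apply: nr (lexx r) (Ad _ _ rq Aq).
by move=> nq; apply: nq (lexx q) (perp_down qp Ap).
Qed.

Lemma perp_regular A : (forall p q, q <= p -> A p -> A q) ->
  perp (perp (perp A)) == perp A.
Proof. by move=> Ad; apply/eqP/perp3. Qed.

Definition ro_compl (U : regular_open) : regular_open :=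
  RegularOpen (perp_regular (@ro_down U)).

Lemma bigcap_regular (F : set (set P)) :
  (forall A, F A -> perp (perp A) = A) ->
  perp (perp (\bigcap_(A in F) A)) == \bigcap_(A in F) A.
Proof.
move=> FR; apply/eqP/seteqP; split=> p.
  move=> Ip A FA; rewrite -(FR _ FA); apply: perpS Ip.
  by apply: perpS; apply: bigcap_inf.
move=> Ip q qp nq; apply: nq (lexx q) _ => A FA.
by have := Ip A FA; rewrite -(FR _ FA); apply: perp_down.
Qed.

Definition ro_bigmeet (F : set regular_open) : regular_open.
Proof.
apply: (@RegularOpen (\bigcap_(A in [set ro_set U | U in F]) A)).
by apply: bigcap_regular => _ [U _ <-]; apply: perp_perp.
Defined.

Lemma setI_regular (U V : regular_open) : perp (perp (U `&` V)%classic) == (U `&` V)%classic.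
Proof.
have <- : \bigcap_(A in [set (U : set P); (V : set P)]) A = (U `&` V)%classic.
  by rewrite bigcap_setU !bigcap_set1.
by apply: bigcap_regular => _ [->|->]; apply: perp_perp.
Qed.

Definition ro_meet U V : regular_open := RegularOpen (setI_regular U V).
Definition ro_join U V : regular_open :=
  ro_compl (ro_meet (ro_compl U) (ro_compl V)).

Definition ro_le (U V : regular_open) : bool := `[< U `<=` V >].

Fact ro_le_refl : reflexive ro_le.
Proof. by move=> U; apply/asboolP. Qed.
Fact ro_le_anti : antisymmetric ro_le.
Proof.
move=> U V /andP[/asboolP UV /asboolP VU]; apply: ro_inj.
by apply/seteqP.
Qed.
Fact ro_le_trans : transitive ro_le.
Proof.
by move=> V U W /asboolP UV /asboolP VW; apply/asboolP/(subset_trans UV).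
Qed.

HB.instance Definition _ := Order.Le_isPOrder.Build d regular_open
  ro_le_refl ro_le_anti ro_le_trans.

Lemma ro_leP (U V : regular_open) : reflect (U `<=` V) (U <= V).
Proof. exact: asboolP. Qed.

Lemma ro_complK : involutive ro_compl.
Proof. by move=> U; apply/ro_inj/perp_perp. Qed.

Lemma ro_compl_le U V : (ro_compl U <= ro_compl V) = (V <= U).
Proof.
apply/ro_leP/ro_leP; last exact: perpS.
by move/perpS; rewrite /= !perp_perp.
Qed.

Fact ro_lexI U V W : (U <= ro_meet V W) = (U <= V) && (U <= W).
Proof.
apply/ro_leP/andP; first by rewrite /= subsetI => -[? ?]; split; apply/ro_leP.
by case=> /ro_leP ? /ro_leP ?; rewrite /= subsetI.
Qed.

Fact ro_leUx U V W : (ro_join U V <= W) = (U <= W) && (V <= W).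
Proof.
by rewrite -[W]ro_complK /ro_join ro_compl_le ro_lexI !ro_complK !ro_compl_le.
Qed.

HB.instance Definition _ := Order.POrder_MeetJoin_isLattice.Build d regular_open
  ro_lexI ro_leUx.

Fact ro_meetUl : left_distributive
  (Order.meet : regular_open -> _ -> _) Order.join.
Proof.
move=> U V W; apply/le_anti/andP; split; last first.
  by rewrite leUx !lexI !leIr !(le_trans (leIl _ _)) ?leUl ?leUr.
change (ro_meet (ro_join U V) W <= ro_join (ro_meet U W) (ro_meet V W)).
apply/ro_leP => p [Jp Wp] q qp [nU nV].
apply: (Jp q qp); split=> r rq Xr.
- by apply: (nU r rq); split=> //; apply: ro_down Wp; apply: le_trans qp.
- by apply: (nV r rq); split=> //; apply: ro_down Wp; apply: le_trans qp.
Qed.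

HB.instance Definition _ :=
  Order.Lattice_Meet_isDistrLattice.Build d regular_open ro_meetUl.

Lemma ro0_subproof : perp (perp set0) == set0 :> set P.
Proof.
by apply/eqP/seteqP; split=> // p np; apply: (np p (lexx p)) => q _ [].
Qed.

Definition ro_bot : regular_open := RegularOpen ro0_subproof.
Definition ro_top : regular_open := ro_compl ro_bot.

Fact ro_le0x U : ro_bot <= U. Proof. by apply/ro_leP. Qed.
Fact ro_lex1 U : U <= ro_top.
Proof. by rewrite -[U]ro_complK ro_compl_le ro_le0x. Qed.

HB.instance Definition _ := Order.hasBottom.Build d regular_open ro_le0x.
HB.instance Definition _ := Order.hasTop.Build d regular_open ro_lex1.

Fact ro_meetxC (U : regular_open) : U `&` ro_compl U = \bot.
Proof.
apply/ro_inj/seteqP; split=> // p [Up nUp].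
by case: (nUp p (lexx p)).
Qed.

Fact ro_joinxC (U : regular_open) : U `|` ro_compl U = \top.
Proof.
apply: (inv_inj ro_complK).
change (ro_compl (ro_join U (ro_compl U)) = ro_compl (ro_compl ro_bot)).
rewrite /ro_join !ro_complK.
exact: etrans (meetC (ro_compl U) U) (ro_meetxC U).
Qed.

HB.instance Definition _ := Order.TBDistrLattice_hasComplement.Build d
  regular_open ro_joinxC ro_meetxC.

Lemma ro_bigmeetP (F : set regular_open) (V : regular_open) :
  reflect (forall U, F U -> V <= U) (V <= ro_bigmeet F).
Proof.
apply: (iffP (ro_leP _ _)) => /= [VI U FU|VF p Vp _ [U FU <-]].
  by apply/ro_leP => p /VI; apply; exists U.
by have /ro_leP := VF U FU; apply.
Qed.

Definition ro_of (p : P) : regular_open.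
Proof.
apply: (@RegularOpen (perp (perp [set q | q <= p]))).
by apply: perp_regular => q r rq; apply: perp_down rq.
Defined.

Lemma ro_of_homo : {homo ro_of : p q / p <= q}.
Proof. by move=> p q pq; apply/ro_leP/perpS/perpS => r /le_trans; apply. Qed.

Lemma ro_of_neq0 p : ro_of p != \bot.
Proof.
apply/eqP => /(congr1 ro_set) /= E; have : (set0 : set P) p by rewrite -E => q qp /(_ q (lexx q)).
by [].
Qed.

Lemma ro_of_dense (U : regular_open) : U != \bot -> exists p, ro_of p <= U.
Proof.
move=> /eqP U0; have [p Up] : (U : set P) !=set0.
  by apply/set0P/eqP => E; apply: U0; apply: ro_inj.
exists p; apply/ro_leP; rewrite -(perp_perp U); apply: perpS; apply: perpS.
by move=> q qp; apply: ro_down Up.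
Qed.

End RegularOpen.

Section Nonzero.
Context {d : Order.disp_t} (B : ctbDistrLatticeType d).

Record nonzero := Nonzero { nz_val :> B; _ : nz_val != \bot }.

HB.instance Definition _ := [isSub for nz_val].
HB.instance Definition _ := [Choice of nonzero by <:].
HB.instance Definition _ := [SubChoice_isSubPOrder of nonzero by <: with d].

End Nonzero.

(** Regular open sets of [nonzero B]: see [ro_complete], [ro_emb_mono],
    [ro_emb_dense] below. *)
Definition ro d (B : ctbDistrLatticeType d) : ctbDistrLatticeType d :=
  regular_open (nonzero B).

Section Completion.
Context {d : Order.disp_t} (B : ctbDistrLatticeType d).

Lemma ro_complete (F : set (ro B)) :
  exists V : ro B, forall W : ro B, W <= V <-> (forall U, F U -> W <= U).
Proof. by exists (ro_bigmeet F) => W; split => /ro_bigmeetP. Qed.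

Lemma ro_emb_subproof (b : B) :
  perp (perp [set p : nonzero B | (p : B) <= b])
    == [set p : nonzero B | (p : B) <= b].
Proof.
have le_nz (p q : nonzero B) : (p <= q) = ((p : B) <= (q : B)) by [].
apply/eqP/seteqP; split=> p /=; last first.
  by move=> pb q qp nq; apply: (nq q (lexx q)); apply: le_trans pb.
move=> np; apply: contrapT => /negP pb.
have pb0 : (p : B) `\` b != \bot by rewrite diff_eq0.
apply: (np (Nonzero pb0)); first by rewrite le_nz leBx.
move=> q; rewrite le_nz /= => qpb qb.
case: q qpb qb => q /= /negP q0 qpb qb; apply: q0.
by rewrite -lex0 -(diffKI (p : B) b) lexI qb qpb.
Qed.

Definition ro_emb (b : B) : ro B := RegularOpen (ro_emb_subproof b).

Lemma ro_emb_mono : {mono ro_emb : b c / b <= c}.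
Proof.
move=> b c; apply/ro_leP/idP => [bc|bc p /le_trans]; last exact.
have [->|b0] := eqVneq b \bot; first exact: le0x.
by have := bc (Nonzero b0); apply; rewrite /= lexx.
Qed.

Lemma ro_emb_dense (U : ro B) :
  U != \bot -> exists2 b, b != \bot & ro_emb b <= U.
Proof.
move=> /eqP U0; have [p Up] : (U : set (nonzero B)) !=set0.
  by apply/set0P/eqP => E; apply: U0; apply: ro_inj.
exists (p : B); first exact: (valP p).
by apply/ro_leP => q qp; apply: ro_down Up.
Qed.

End Completion.

Record ba_congr d (B : ctbDistrLatticeType d) := BaCongr {
  congr_rel :> equiv_rel B;
  congr_meet : forall x x' y y', congr_rel x x' -> congr_rel y y' ->
    congr_rel (x `&` y) (x' `&` y');
  congr_join : forall x x' y y', congr_rel x x' -> congr_rel y y' ->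
    congr_rel (x `|` y) (x' `|` y');
  congr_compl : forall x x', congr_rel x x' -> congr_rel (~` x) (~` x') }.

(** [d'] is the display given to the order of the quotient. *)
Definition ba_quot (d' : Order.disp_t) d (B : ctbDistrLatticeType d)
  (e : ba_congr B) : Type := {eq_quot e}.

Section BaQuot.
Context (d' : Order.disp_t) {d : Order.disp_t} {B : ctbDistrLatticeType d}.
Variable e : ba_congr B.
Local Notation Q := (ba_quot d' e).
Implicit Types (x y z : Q) (a b c : B).

HB.instance Definition _ := Choice.copy Q {eq_quot e}.
HB.instance Definition _ := EqQuotient.copy Q {eq_quot e}.

Definition ba_pi (b : B) : Q := \pi_{eq_quot e} b.

Lemma ba_piP a b : reflect (ba_pi a = ba_pi b) (e a b).
Proof. by rewrite -[e a b]eqmodE; apply: eqP. Qed.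

Lemma ba_quotW (S : Q -> Prop) : (forall b, S (ba_pi b)) -> forall x, S x.
Proof. by move=> Sb x; rewrite -[x]reprK; apply: Sb. Qed.

Lemma ba_repr_pi b : e (repr (ba_pi b)) b.
Proof. by apply/ba_piP; rewrite /ba_pi reprK. Qed.

Definition ba_quot_meet x y : Q := ba_pi (repr x `&` repr y).
Definition ba_quot_join x y : Q := ba_pi (repr x `|` repr y).
Definition ba_quot_compl x : Q := ba_pi (~` repr x).

Lemma ba_quot_meetE a b : ba_quot_meet (ba_pi a) (ba_pi b) = ba_pi (a `&` b).
Proof. by apply/ba_piP/congr_meet; apply: ba_repr_pi. Qed.
Lemma ba_quot_joinE a b : ba_quot_join (ba_pi a) (ba_pi b) = ba_pi (a `|` b).
Proof. by apply/ba_piP/congr_join; apply: ba_repr_pi. Qed.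
Lemma ba_quot_complE a : ba_quot_compl (ba_pi a) = ba_pi (~` a).
Proof. by apply/ba_piP/congr_compl; apply: ba_repr_pi. Qed.

Definition ba_quot_le x y : bool := ba_quot_meet x y == x.
Definition ba_quot_lt x y : bool := (y != x) && ba_quot_le x y.

Local Definition ba_quotE := (ba_quot_meetE, ba_quot_joinE, ba_quot_complE).

Fact ba_quot_meetC : commutative ba_quot_meet.
Proof. by elim/ba_quotW=> a; elim/ba_quotW=> b; rewrite !ba_quotE meetC. Qed.
Fact ba_quot_joinC : commutative ba_quot_join.
Proof. by elim/ba_quotW=> a; elim/ba_quotW=> b; rewrite !ba_quotE joinC. Qed.
Fact ba_quot_meetA : associative ba_quot_meet.
Proof.
by elim/ba_quotW=> a; elim/ba_quotW=> b; elim/ba_quotW=> c;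
  rewrite !ba_quotE meetA.
Qed.
Fact ba_quot_joinA : associative ba_quot_join.
Proof.
by elim/ba_quotW=> a; elim/ba_quotW=> b; elim/ba_quotW=> c;
  rewrite !ba_quotE joinA.
Qed.
Fact ba_quot_joinKI y x : ba_quot_meet x (ba_quot_join x y) = x.
Proof.
by elim/ba_quotW: x=> a; elim/ba_quotW: y=> b; rewrite !ba_quotE joinKI.
Qed.
Fact ba_quot_meetKU y x : ba_quot_join x (ba_quot_meet x y) = x.
Proof.
by elim/ba_quotW: x=> a; elim/ba_quotW: y=> b; rewrite !ba_quotE meetKU.
Qed.
Fact ba_quot_meetUl : left_distributive ba_quot_meet ba_quot_join.
Proof.
by elim/ba_quotW=> a; elim/ba_quotW=> b; elim/ba_quotW=> c;
  rewrite !ba_quotE meetUl.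
Qed.
Fact ba_quot_meetxx : idempotent_op ba_quot_meet.
Proof. by elim/ba_quotW=> a; rewrite !ba_quotE meetxx. Qed.

HB.instance Definition _ := Order.isMeetJoinDistrLattice.Build d' Q
  (fun _ _ => erefl : ba_quot_le _ _ = _) (fun _ _ => erefl : ba_quot_lt _ _ = _)
  ba_quot_meetC ba_quot_joinC ba_quot_meetA ba_quot_joinA
  ba_quot_joinKI ba_quot_meetKU ba_quot_meetUl ba_quot_meetxx.

Fact ba_quot_le0x x : ba_pi \bot <= x.
Proof.
by elim/ba_quotW: x => a; apply/eqP; rewrite [LHS]ba_quotE meet0x.
Qed.
Fact ba_quot_lex1 x : x <= ba_pi \top.
Proof.
by elim/ba_quotW: x => a; apply/eqP; rewrite [LHS]ba_quotE meetx1.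
Qed.

HB.instance Definition _ := Order.hasBottom.Build d' Q ba_quot_le0x.
HB.instance Definition _ := Order.hasTop.Build d' Q ba_quot_lex1.

Fact ba_quot_joinxC x : x `|` ba_quot_compl x = \top.
Proof.
by elim/ba_quotW: x => a; rewrite ba_quotE [LHS]ba_quotE joinxC.
Qed.
Fact ba_quot_meetxC x : x `&` ba_quot_compl x = \bot.
Proof.
by elim/ba_quotW: x => a; rewrite ba_quotE [LHS]ba_quotE meetxC.
Qed.

HB.instance Definition _ := Order.TBDistrLattice_hasComplement.Build d' Q
  ba_quot_joinxC ba_quot_meetxC.

Lemma ba_pi_le a b : (ba_pi a <= ba_pi b) = e (a `&` b) a.
Proof.
apply/eqP/idP => [E|/ba_piP E]; last by rewrite [LHS]ba_quot_meetE.
by apply/ba_piP; rewrite -ba_quot_meetE.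
Qed.

End BaQuot.

Section FunBA.
Context (T : Type) {d : Order.disp_t} (B : ctbDistrLatticeType d).

Fact fun_meetUl : left_distributive
  (Order.meet : (T -> B) -> _ -> _) Order.join.
Proof. by move=> f g h; apply/funext => x; apply: meetUl. Qed.
HB.instance Definition _ :=
  Order.Lattice_Meet_isDistrLattice.Build FunOrder.fun_display (T -> B) fun_meetUl.

Fact fun_le0x (f : T -> B) : (fun=> \bot) <= f.
Proof. by apply/lefP => x; apply: le0x. Qed.
Fact fun_lex1 (f : T -> B) : f <= (fun=> \top).
Proof. by apply/lefP => x; apply: lex1. Qed.
HB.instance Definition _ :=
  Order.hasBottom.Build FunOrder.fun_display (T -> B) fun_le0x.
HB.instance Definition _ :=
  Order.hasTop.Build FunOrder.fun_display (T -> B) fun_lex1.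

Definition fun_compl (f : T -> B) : T -> B := fun x => ~` f x.
Fact fun_joinxC (f : T -> B) : f `|` fun_compl f = \top.
Proof. by apply/funext => x; apply: joinxC. Qed.
Fact fun_meetxC (f : T -> B) : f `&` fun_compl f = \bot.
Proof. by apply/funext => x; apply: meetxC. Qed.
HB.instance Definition _ := Order.TBDistrLattice_hasComplement.Build
  FunOrder.fun_display (T -> B) fun_joinxC fun_meetxC.

End FunBA.

Section ReducedPower.
Context {d : Order.disp_t} (B : ctbDistrLatticeType d).
Implicit Types b c : nat -> B.

Definition eventually_eq b c : bool := `[< \forall i \near \oo, b i = c i >].

Fact eventually_eq_refl : reflexive eventually_eq.
Proof. by move=> b; apply/asboolP; near=> i. Unshelve. all: by end_near. Qed.
Fact eventually_eq_sym : symmetric eventually_eq.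
Proof.
by move=> b c; apply/asboolP/asboolP; apply: filterS => i ->.
Qed.
Fact eventually_eq_trans : transitive eventually_eq.
Proof.
by move=> c b a /asboolP bc /asboolP ca; apply/asboolP;
  apply: filterS2 bc ca => i -> ->.
Qed.

Canonical eventually_eq_equiv := EquivRel eventually_eq
  eventually_eq_refl eventually_eq_sym eventually_eq_trans.

Definition frechet_congr : ba_congr (nat -> B).
Proof.
apply: (@BaCongr _ _ eventually_eq_equiv) => [a a' b b'|a a' b b'|b b'].
- move=> /asboolP aa' /asboolP bb'; apply/asboolP.
  by apply: filterS2 aa' bb' => i E1 E2; rewrite /Order.meet /= /FunOrder.meetf E1 E2.
- move=> /asboolP aa' /asboolP bb'; apply/asboolP.
  by apply: filterS2 aa' bb' => i E1 E2; rewrite /Order.join /= /FunOrder.joinf E1 E2.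
- move=> /asboolP bb'; apply/asboolP.
  by apply: filterS bb' => i E; rewrite /Order.compl /= /fun_compl E.
Defined.

Definition rp : ctbDistrLatticeType d := ba_quot d frechet_congr.

Lemma rp_le b c : ((ba_pi d frechet_congr b : rp) <= ba_pi d frechet_congr c)
  = `[< \forall i \near \oo, b i <= c i >].
Proof.
rewrite ba_pi_le; apply/asboolP/asboolP; apply: filterS => i.
  by move/eqP; rewrite -leEmeet.
by move=> bc; apply/eqP; rewrite -leEmeet.
Qed.

End ReducedPower.

Fixpoint rpn (n : nat) d (B : ctbDistrLatticeType d) : ctbDistrLatticeType d :=
  if n is n'.+1 then rp (rpn n' B) else B.

Section PomegaFin.
Implicit Types A B C : set nat.

Definition eq_mod_fin A B : bool := `[< finite_set (A `+` B) >].

Lemma eq_mod_finS A B A' B' A1 B1 : 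
    A `+` B `<=` ((A' `+` B') `|` (A1 `+` B1))%classic ->
  eq_mod_fin A' B' -> eq_mod_fin A1 B1 -> eq_mod_fin A B.
Proof.
move=> sub /asboolP f1 /asboolP f2; apply/asboolP.
by apply: (sub_finite_set sub); rewrite finite_setU.
Qed.

Fact eq_mod_fin_refl : reflexive eq_mod_fin.
Proof. by move=> A; apply/asboolP; rewrite setYK. Qed.
Fact eq_mod_fin_sym : symmetric eq_mod_fin.
Proof. by move=> A B; rewrite /eq_mod_fin setYC. Qed.
Fact eq_mod_fin_trans : transitive eq_mod_fin.
Proof.
move=> B A C; apply: eq_mod_finS => x; rewrite !setY_def /setU /setD /=.
by have := EM (B x); tauto.
Qed.

Canonical eq_mod_fin_equiv := EquivRel eq_mod_fin
  eq_mod_fin_refl eq_mod_fin_sym eq_mod_fin_trans.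

Definition fin_congr : ba_congr (set nat).
Proof.
apply: (@BaCongr _ _ eq_mod_fin_equiv) => [A A' B B'|A A' B B'|A A'].
- apply: (@eq_mod_finS (A `&` B)%classic (A' `&` B')%classic) => x.
  rewrite !setY_def /setU /setD /setI /=; have := EM (A x); have := EM (A' x); tauto.
- apply: (@eq_mod_finS (A `|` B)%classic (A' `|` B')%classic) => x.
  rewrite !setY_def /setU /setD /=; have := EM (A x); have := EM (A' x); tauto.
- move=> h; apply: (@eq_mod_finS (~` A)%classic (~` A')%classic _ _ _ _ _ h h).
  by move=> x; rewrite !setY_def /setU /setD /setC /=; have := EM (A x); have := EM (A' x); tauto.
Defined.

Definition Pomega_fin : ctbDistrLatticeType forcing_display :=
  ba_quot forcing_display fin_congr.

Lemma Pomega_fin_le A B :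
  ((ba_pi _ fin_congr A : Pomega_fin) <= ba_pi _ fin_congr B)
  = `[< finite_set (A `\` B) >].
Proof.
rewrite ba_pi_le /= /eq_mod_fin; congr (`[< finite_set _ >]).
apply/seteqP; split=> x; rewrite setY_def /setU /setD /setI /Order.meet /=;
  have := EM (B x); tauto.
Qed.

End PomegaFin.

(** A cardinal that is only used as a cardinality is represented by a type of
    that cardinality, and one whose ordinals matter by an initial ordinal: a
    well-order equinumerous to none of its proper initial segments. *)

Definition is_cardinal d (L : orderType d) : Prop :=
  well_founded (fun x y : L => x < y) /\
  forall x : L, ~ ([set: L] #<= [set y : L | y < x]).

(** [A] is a member of least size of the family [F]. *)
Definition least_size T (F : set (set T)) (A : set T) : Prop :=
  F A /\ forall B, F B -> A #<= B.

Definition cofinal d (L : orderType d) (A : set L) : Prop :=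
  forall x : L, exists2 a, A a & x <= a.

(** [A] has cardinality [cf L]. *)
Definition is_cf d (L : orderType d) (A : set L) : Prop :=
  least_size [set B : set L | cofinal B] A.

Definition continuum : Type := nat -> bool.

(** [omega1] consists of the elements with countably many predecessors in a
    well-ordering of [continuum]: these form an initial segment, which is the
    first uncountable one, see [omega1_lt_countable], [omega1_uncountable]. *)

Section Omega1.

Definition wo : rel continuum :=
  projT1 (wochoice.well_ordering_principle continuum).

Record omega1 := Omega1 {
  o1_val :> continuum;
  _ : `[< countable [set y : continuum | wo y o1_val] >] }.

HB.instance Definition _ := [isSub for o1_val].
HB.instance Definition _ := [Choice of omega1 by <:].

Definition o1_le (x y : omega1) : bool := wo x y.

Lemma wo_wo : wochoice.well_order wo.
Proof. exact: projT2 (wochoice.well_ordering_principle continuum). Qed.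

Let wo_chain : wochoice.wo_chain wo predT.
Proof. by move=> A _; apply: wo_wo. Qed.

Lemma wo_refl : reflexive wo.
Proof. by move=> x; apply: (wochoice.wo_chain_reflexive wo_chain). Qed.
Lemma wo_anti : antisymmetric wo.
Proof. by move=> x y; apply: (wochoice.wo_chain_antisymmetric wo_chain). Qed.
Lemma wo_total : total wo.
Proof. by move=> x y; apply: (wochoice.wo_chainW wo_chain). Qed.
Lemma wo_min (A : set continuum) : A !=set0 ->
  exists2 z, A z & forall x, A x -> wo z x.
Proof.
case=> a Aa; have [|z [[Az zA] _]] := @wo_wo (mem A).
  by exists a; apply/mem_set.
exists z; first by apply/set_mem.
by move=> x Ax; apply: zA; apply/mem_set.
Qed.
Lemma wo_trans : transitive wo.
Proof.
move=> y x z xy yz.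
have [|m] := @wo_min [set x; y; z]; first by exists x; left; left.
case=> [[->|->]|->] mle.
- by apply: mle; right.
- suff <- : y = x by [].
  by apply: wo_anti; rewrite xy andbT; apply: mle; left; left.
- suff -> : z = y by [].
  by apply: wo_anti; rewrite yz andbT; apply: mle; left; right.
Qed.

Fact o1_le_refl : reflexive o1_le. Proof. by move=> x; apply: wo_refl. Qed.
Fact o1_le_anti : antisymmetric o1_le.
Proof. by move=> x y /wo_anti; apply: val_inj. Qed.
Fact o1_le_trans : transitive o1_le.
Proof. by move=> y x z; apply: wo_trans. Qed.
Fact o1_le_total : total o1_le.
Proof. by move=> x y; apply: wo_total. Qed.

HB.instance Definition _ := Order.Le_isPOrder.Build forcing_display omega1
  o1_le_refl o1_le_anti o1_le_trans.
HB.instance Definition _ :=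
  Order.POrder_isTotal.Build forcing_display omega1 o1_le_total.

Lemma omega1_wf : well_founded (fun x y : omega1 => x < y).
Proof.
move=> x; apply: contrapT => nx.
have [|_ [z nz <-] zmin] := @wo_min
    [set o1_val y | y in [set y | ~ Acc (fun x y : omega1 => x < y) y]].
  by exists (o1_val x), x.
apply: nz; split=> y yz; apply: contrapT => ny.
have : z <= y by apply: zmin; exists y.
by rewrite leNgt yz.
Qed.

Lemma omega1_lt_countable (x : omega1) : countable [set y : omega1 | y < x].
Proof.
have /asboolP/countable_injP[f fI] := valP x.
apply/countable_injP; exists (f \o o1_val) => y z /set_mem /= yx /set_mem /= zx E.
by apply/val_inj/fI => //; apply/mem_set; [apply: (ltW yx)|apply: (ltW zx)].
Qed.

Lemma continuum_uncountable : ~ countable [set: continuum].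
Proof.
move=> /countable_injP[f fI].
pose diag n := ~~ `[< exists2 g : continuum, f g = n & g n >].
have := erefl (diag (f diag)); rewrite {1}/diag.
case: asboolP => [[g fg gn]|ndiag] /=.
  by have <- : g = diag by [apply: fI; rewrite ?in_setT]; rewrite fg gn.
by move=> E; apply: ndiag; exists diag.
Qed.

Lemma omega1_uncountable : ~ countable [set: omega1].
Proof.
move=> ctb.
have cS : countable [set o1_val y | y in [set: omega1]].
  by apply: sub_countable ctb; apply: card_image_le.
have [[x nx]|Sall] := pselect (exists x, ~ [set o1_val y | y in [set: omega1]] x).
  have [|z nz zmin] := @wo_min (~` [set o1_val y | y in [set: omega1]])%classic.
    by exists x.
  have cz : `[< countable [set y | wo y z] >].
    apply/asboolP; have /countable_injP[f fI] := cS.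
    have inS y : wo y z -> y <> z -> [set o1_val y | y in [set: omega1]] y.
      move=> yz yNz; apply: contrapT => ny.
      by apply: yNz; apply: wo_anti; rewrite yz zmin.
    apply/countable_injP.
    exists (fun y => if y == z then 0%N else (f y).+1) => u v.
    move=> /set_mem /= uz /set_mem /= vz.
    case: eqVneq => [->|/eqP uNz]; case: eqVneq => [->|/eqP vNz] // [] E.
    by apply: fI => //; apply/mem_set/inS.
  by apply: nz; exists (Omega1 cz).
apply: continuum_uncountable; apply: sub_countable cS; apply: subset_card_le.
by move=> y _; apply: contrapT => ny; apply: Sall; exists y.
Qed.

Lemma omega1_is_cardinal : is_cardinal omega1.
Proof.
split=> [|x le]; first exact: omega1_wf.
by apply: omega1_uncountable; apply: card_le_trans le (omega1_lt_countable x).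
Qed.

End Omega1.

Section Tree.
Context {d : Order.disp_t} (L : orderType d) (K : Type).

(** Functions into [K] whose domain is a proper initial segment [{x | x < a}]
    of [L], compared by reverse extension. When [L] is an infinite
    cardinal, the points [a] of [L] stand for the ordinals below [L]. *)
Record tree := Tree {
  tree_fun :> L -> option K;
  _ : exists a : L, forall x, isSome (tree_fun x) = (x < a) }.

HB.instance Definition _ := gen_eqMixin tree.
HB.instance Definition _ := gen_choiceMixin tree.

Definition tree_le (f g : tree) : bool :=
  `[< forall x k, g x = Some k -> f x = Some k >].

Fact tree_le_refl : reflexive tree_le.
Proof. by move=> f; apply/asboolP. Qed.
Fact tree_le_anti : antisymmetric tree_le.
Proof.
move=> [f pf] [g pg] /andP[/asboolP /= fg /asboolP /= gf].
suff E : f = g by by case: _ / E pg {fg gf} => pg; congr Tree; apply: Prop_irrelevance.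
apply/funext => x; case E: (g x) => [k|]; first exact: fg.
by case F: (f x) => [k|//]; rewrite (gf _ _ F) in E.
Qed.
Fact tree_le_trans : transitive tree_le.
Proof.
by move=> g f h /asboolP fg /asboolP gh; apply/asboolP => x k /gh /fg.
Qed.

HB.instance Definition _ := Order.Le_isPOrder.Build forcing_display tree
  tree_le_refl tree_le_anti tree_le_trans.

Definition Col : ctbDistrLatticeType forcing_display := regular_open tree.

End Tree.

Section Distributivity.
Context {d : Order.disp_t} (P : porderType d).

Definition order_dense (D : set P) : Prop := forall p, exists2 q, D q & q <= p.

Definition order_open (D : set P) : Prop := forall p q, q <= p -> D p -> D q.

(** [F] has cardinality the distributivity number of [P]. *)
Definition is_distributivity (F : set (set P)) : Prop :=
  least_size [set G : set (set P) |
    (forall D, G D -> order_dense D /\ order_open D) /\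
    ~ order_dense (\bigcap_(D in G) D)] F.

End Distributivity.

(** [F] has cardinality 𝔥. *)
Definition is_h (F : set (set (nonzero Pomega_fin))) : Prop :=
  is_distributivity F.

(* Main.v *)
Require Import Defs.
From mathcomp Require Import all_boot all_order.
From mathcomp Require Import boolp classical_sets functions cardinality filter.

Import Order.Theory.

Set Implicit Arguments.
Unset Strict Implicit.
Unset Printing Implicit Defensive.

Local Open Scope classical_set_scope.
Local Open Scope card_scope.
Local Open Scope order_scope.

(** Two facts carry the theorem.

    First, let [P] be a sigma-closed poset with a dense family indexed by [M],
    and let [f] be a name of a partial function from [omega1] to [M] such that
    below every condition some value [f a] can still be forced to be any
    element of [M]. Choose, at level [a] of a tree
    of height [omega1], a maximal antichain of conditions deciding [f a] (and
    whether the [f a]-th member of the dense family is in the generic filter)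
    below every branch; the undecided values of [f] make these antichains have
    size exactly [M], and the nodes are dense in [P]. Hence [P] has the regular
    open algebra of the tree of countable sequences in [M].

    Second, a reduced power is sigma-closed, and a name for [B] that is
    undecided at every large index [g < lambda] yields one for [rp B]: read
    the value at [g] coordinatewise, requiring it to be constant. Countably
    many bounds below [lambda] have a common one since [cf lambda > omega]. It
    remains to name [g] by a countable ordinal, which is immediate if
    [cf lambda = omega1]; otherwise [h = omega1] gives omega1 refining maximal
    antichains of [P(omega)/Fin] (the base matrix of Balcar, Pelant and Simon)
    which decide [g] in terms of a countable ordinal. The tree produced by the
    first fact provides again a name undecided at all large indices, so the
    argument iterates along [rp^n]. *)

(** * Isomorphisms and cardinalities *)

Section BaIso.
Context {d1 d2 d3 : Order.disp_t} {A : ctbDistrLatticeType d1}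
  {B : ctbDistrLatticeType d2} {C : ctbDistrLatticeType d3}.

Lemma ba_iso_sym : A ≅ B -> B ≅ A.
Proof.
case=> f [g fK gK] fM; exists g; first by exists f.
by move=> x y; rewrite -fM !gK.
Qed.

Lemma ba_iso_trans : A ≅ B -> B ≅ C -> A ≅ C.
Proof.
case=> f fb fM [g gb gM]; exists (g \o f); first exact: bij_comp.
by move=> x y; rewrite /= gM fM.
Qed.

End BaIso.

Section Cardinals.

Lemma inj_card_leq T U (A : set T) (B : set U) (f : T -> U) :
  (forall x, A x -> B (f x)) ->
  (forall x y, A x -> A y -> f x = f y -> x = y) -> A #<= B.
Proof.
move=> fAB fI; have [[a Aa]|A0] := pselect (A !=set0); last first.
  suff -> : A = set0 by exact: card_ge0.
  by apply/seteqP; split=> // x Ax; apply: A0; exists x.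
have fA : f @` A #= A.
  by apply: inj_card_eq => x y /set_mem Ax /set_mem Ay; apply: fI.
by rewrite -(card_le_eql fA); apply: subset_card_le => _ [x /fAB ? <-].
Qed.

Lemma card_leq_inj T U (A : set T) (B : set U) (u0 : U) : A #<= B ->
  exists f : T -> U, (forall x, A x -> B (f x)) /\
    (forall x y, A x -> A y -> f x = f y -> x = y).
Proof.
move=> /card_leP[f].
exists (fun x => if pselect (A x) is left Ax then val (f (SigSub (mem_set Ax)))
  else u0).
split=> [x Ax|x y Ax Ay]; case: pselect => // Ax'.
  by apply: set_mem; apply: valP.
case: pselect => // Ay' /val_inj /(@inj _ _ _ f).
by move=> /(_ (mem_set I) (mem_set I)) [].
Qed.

Lemma card_leq_surj T U (A : set T) (B : set U) (b0 : U) : B b0 -> B #<= A ->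
  exists f : T -> U, (forall x, B (f x)) /\ (forall y, B y -> exists2 x,
    A x & f x = y).
Proof.
move=> Bb0 BA; have [[b Bb]|B0] := pselect (A !=set0); last first.
  have A0 : A = set0 by apply/seteqP; split=> // x Ax; apply: B0; exists x.
  by move: BA; rewrite A0 card_le0 => /eqP E; rewrite E in Bb0.
have [g [gA gI]] := card_leq_inj b BA.
have [f fP] : {f : T -> U & forall x, B (f x) /\
    forall y, B y -> g y = x -> f x = y}.
  apply: (@choice _ _ (fun x z => B z /\ forall y, B y -> g y = x -> z = y)) => x.
  have [[y By yx]|nx] := pselect (exists2 y, B y & g y = x).
    by exists y; split=> // y' By' E; apply: gI => //; rewrite yx E.
  by exists b0; split=> // y By E; case: nx; exists y.
exists f; split=> [x|y By]; first by case: (fP x).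
by exists (g y); [exact: gA|case: (fP (g y)) => _; apply].
Qed.

Lemma card_eq_bij T U (A : set T) (B : set U) (u0 : U) : A #= B ->
  exists f : T -> U, [/\ forall x, A x -> B (f x),
    forall x y, A x -> A y -> f x = f y -> x = y &
    forall y, B y -> exists2 x, A x & f x = y].
Proof.
move=> /card_bijP[f [g fK gK]].
exists (fun x => if pselect (A x) is left Ax then val (f (SigSub (mem_set Ax)))
  else u0).
split=> [x Ax|x y Ax Ay|y By].
- by case: pselect => // Ax'; exact: (set_mem (valP (f _))).
- case: pselect => // Ax'; case: pselect => // Ay' /val_inj /(can_inj fK).
  by case.
have gA : A (val (g (SigSub (mem_set By)))) by exact: (set_mem (valP (g _))).
exists (val (g (SigSub (mem_set By)))) => //; case: pselect => // Ax.
by have -> : SigSub (mem_set Ax) = g (SigSub (mem_set By)) by [apply: val_inj];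
  rewrite gK.
Qed.

Lemma countable_enum T (A : set T) (a0 : T) : A a0 -> countable A ->
  exists f : nat -> T, (forall n, A (f n)) /\ forall x, A x -> exists n, f n = x.
Proof.
move=> Aa0 /(card_leq_surj Aa0)[f [fA fS]]; exists f; split=> // x /fS[n _ <-].
by exists n.
Qed.

End Cardinals.

(** * Well-founded recursion and dependent choice *)

Section WellFounded.
Context {T : Type} (R : T -> T -> Prop) (Rwf : well_founded R).

(** Replacing [F] by [x0] off the predecessors of [a] lets [step] take a total function, so
    recursive definitions need no proofs of [R b a]. *)
Lemma wf_recursion X (x0 : X) (step : T -> (T -> X) -> X) : exists F : T -> X,
  forall a, F a = step a (fun b => if `[< R b a >] then F b else x0).
Proof.
pose body a (F : forall b, R b a -> X) :=
  step a (fun b => if pselect (R b a) is left h then F b h else x0).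
exists (Fix Rwf (fun=> X) body) => a.
rewrite Fix_eq => [|b f g fg].
  congr step; apply/funext => b.
  by case: pselect => h; case: asboolP.
by congr step; apply/funext => c; case: pselect.
Qed.

Lemma wf_minimal (A : set T) : A !=set0 ->
  exists2 a, A a & forall b, R b a -> ~ A b.
Proof.
case=> a; elim/(well_founded_ind Rwf): a => a IH Aa.
have [[b Rba Ab]|na] := pselect (exists2 b, R b a & A b); first exact: IH Rba Ab.
by exists a => // b Rba Ab; apply: na; exists b.
Qed.

End WellFounded.

Lemma dependent_choice T (R : T -> T -> Prop) (x0 : T) :
  (forall x, exists y, R x y) ->
  exists u : nat -> T, u 0%N = x0 /\ forall n, R (u n) (u n.+1).
Proof.
by move=> /choice[f fP]; exists (fun n => iter n f x0); split=> // n; apply: fP.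
Qed.

(** * Compatibility and maximal antichains *)

Section Compatibility.
Context {d : Order.disp_t} {P : porderType d}.
Implicit Types (p q r : P) (A S D : set P).

Definition compatible p q : Prop := exists2 r, r <= p & r <= q.

Definition antichain A : Prop :=
  forall p q, A p -> A q -> compatible p q -> p = q.

Lemma compatibleC p q : compatible p q -> compatible q p.
Proof. by case=> r; exists r. Qed.

Lemma compatible_le p p' q q' :
  p <= p' -> q <= q' -> compatible p q -> compatible p' q'.
Proof. by move=> pp qq [r rp rq]; exists r;
  [apply: le_trans pp|apply: le_trans qq]. Qed.

Lemma maximal_antichain S A0 : A0 `<=` S -> antichain A0 -> exists A,
  [/\ A0 `<=` A, A `<=` S, antichain A & forall s, S s -> exists2 a,
    A a & compatible a s].
Proof.
(* Zorn's lemma is applied to the part added to [A0], so that the empty chain is no exception. *)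
move=> A0S A0a; pose F := [set B | [/\ A0 `|` B `<=` S & antichain (A0 `|` B)]].
have [|B [[BS Ba] Bmax]] := @Zorn_bigcup _ F.
  move=> G GF Gtot; split=> [x [/A0S//|[B GB Bx]]|x y].
    by case: (GF _ GB) => + _; apply; right.
  have inG z : (A0 `|` \bigcup_(X in G) X) z -> A0 z \/ exists2 X, G X & X z.
    by [].
  move=> /inG[A0x|[X GX Xx]] /inG[A0y|[Y GY Yy]].
  - exact: A0a.
  - by case: (GF _ GY) => _; apply; [left|right].
  - by case: (GF _ GX) => _; apply; [right|left].
  - case: (Gtot _ _ GX GY) => [XY|YX].
      by case: (GF _ GY) => _; apply; right => //; apply: XY.
    by case: (GF _ GX) => _; apply; right => //; apply: YX.
exists (A0 `|` B); split=> // [x A0x|s Ss]; first by left.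
apply: contrapT => ns.
have nB : ~ (A0 `|` B) s by move=> Bs; apply: ns; exists s => //; exists s.
apply: (Bmax (B `|` [set s])).
  by split=> [x Bx|/(_ s) sB]; [left|apply: nB; right; apply: sB; right].
split=> [x [A0x|[Bx|->//]]|x y]; [by apply: BS; left|by apply: BS; right|].
have inU z : (A0 `|` (B `|` [set s])) z -> (A0 `|` B) z \/ z = s.
  by case=> [?|[?|->]]; [left; left|left; right|right].
move=> /inU[Bx|->] /inU[By|->] // C; first exact: Ba.
  by case: ns; exists x.
by case: ns; exists y => //; apply: compatibleC.
Qed.

End Compatibility.

(** * Isomorphism of regular open algebras along a dense system of open sets *)

Section RegularOpenIso.
Context {d1 d2 : Order.disp_t} {P : porderType d1} {Q : porderType d2}.
Variable W : Q -> set P.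
Hypothesis W_neq0 : forall t, W t !=set0.
Hypothesis W_open : forall t, order_open (W t).
Hypothesis W_homo : forall s t, s <= t -> W s `<=` W t.
Hypothesis W_compatible : forall s t, W s `&` W t !=set0 -> compatible s t.
Hypothesis W_dense : forall p, exists t, forall q, W t q -> q <= p.

Let lower (V : set P) : set Q := [set t | W t `<=` V].

Let in_perp (V : regular_open P) p : ~ ro_set V p -> exists2 q, q <= p & perp V q.
Proof.
rewrite -{1}(perp_perp V) => np; apply: contrapT => nq; apply: np => q qp Vq.
by apply: nq; exists q.
Qed.

Let in_perp' (V : regular_open Q) p : ~ ro_set V p -> exists2 q, q <= p & perp V q.
Proof.
rewrite -{1}(perp_perp V) => np; apply: contrapT => nq; apply: np => q qp Vq.
by apply: nq; exists q.
Qed.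

Let lower_regular (V : regular_open P) : perp (perp (lower V)) == lower V.
Proof.
apply/eqP/seteqP; split=> t; last first.
  by move=> Vt s st ns; apply: ns (lexx s) _; apply: subset_trans Vt; apply: W_homo.
move=> nnt; apply: contrapT => /existsNP[p /not_implyP[Wp /in_perp[q qp nq]]].
have Wq := W_open qp Wp.
have [s sq] := W_dense q; have [r Wr] := W_neq0 s.
have [|u us ut] := @W_compatible s t.
  by exists r; split=> //; apply: W_open Wq; apply: sq.
apply: (nnt u ut) => v vu Vv; have [x Wx] := W_neq0 v.
apply: (nq x); last exact: Vv.
by apply: sq; apply: W_homo Wx; apply: le_trans us.
Qed.

Let phi (V : regular_open P) : regular_open Q := RegularOpen (lower_regular V).

Let U' (U : regular_open Q) : set P := \bigcup_(t in (U : set Q)) W t.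

Let U'_open U : order_open (U' U).
Proof. by move=> p q qp [t Ut Wp]; exists t => //; apply: W_open Wp. Qed.

Let psi U : regular_open P := RegularOpen (perp_regular (perp_down (A := U' U))).

Let psi_ge U : U' U `<=` psi U.
Proof. by move=> p Up q qp nq; apply: nq (lexx q) _; apply: U'_open Up. Qed.

Let phi_mono : {mono phi : U V / U <= V}.
Proof.
move=> U V; apply/ro_leP/ro_leP => [UV p Up|UV t Ut]; last exact: subset_trans UV.
apply: contrapT => /in_perp[q qp nq].
have [s sq] := W_dense q; have [r Wr] := W_neq0 s.
have Vs : lower V s.
  apply: UV => x /sq xq; apply: ro_down Up; exact: le_trans qp.
exact: (nq r (sq _ Wr) (Vs _ Wr)).
Qed.

Let psiK : cancel psi phi.
Proof.
move=> U; apply/ro_inj/seteqP; split=> t; last first.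
  by move=> Ut p Wp; apply: psi_ge; exists t.
move=> Vt; apply: contrapT => /in_perp'[s st ns].
have [p Wp] := W_neq0 s.
have pV := Vt _ (W_homo st Wp).
have [q qp [u Uu Wu]] : exists2 q, q <= p & U' U q.
  apply: contrapT => nq; apply: (pV p (lexx p)) => q qp Uq.
  by apply: nq; exists q.
have [|v vs vu] := @W_compatible s u.
  by exists q; split=> //; apply: W_open Wp.
by apply: (ns v vs); apply: ro_down Uu.
Qed.

(** [W] acts as a dense embedding whose values are open sets instead of conditions, because the
    lower bounds of a branch need not have a largest element. [phi] collects the nodes inside [V],
    and [psi] regularises the union of the [W t]. *)
Lemma regular_open_iso : regular_open P ≅ regular_open Q.
Proof.
exists phi; last exact: phi_mono.
by exists psi => [V|]; [apply: (inc_inj phi_mono); rewrite psiK|apply: psiK].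
Qed.

End RegularOpenIso.

(** * Sigma-closed posets collapsed to omega1 *)

(** Otherwise [omega1] would be a countable union of countable initial segments. *)
Lemma omega1_bounded (u : nat -> omega1) : exists a, forall n, u n < a.
Proof.
apply: contrapT => na; apply: omega1_uncountable.
apply: (@sub_countable _ _ _ (\bigcup_n [set y | y <= u n])).
  apply: subset_card_le => x _; apply: contrapT => nx; apply: na; exists x => n.
  by rewrite ltNge; apply/negP => xu; apply: nx; exists n.
apply: bigcup_countable => // n _.
apply: (@sub_countable _ _ _
    (\bigcup_b (if b : bool then [set u n] else [set y | y < u n]))).
  by apply: subset_card_le => y /=; rewrite le_eqVlt => /orP[/eqP|];
    [exists true|exists false].
by apply: bigcup_countable => // -[] _; [exact: countable1|exact:
  omega1_lt_countable].
Qed.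

Section SigmaClosed.
Context {d : Order.disp_t} (P : porderType d).

Definition sigma_closed : Prop := forall u : nat -> P,
  (forall n, u n.+1 <= u n) -> exists q, forall n, q <= u n.

Hypothesis Pclosed : sigma_closed.

Lemma sigma_distributive I (A : set I) (D : I -> set P) : countable A ->
  (forall i, A i -> order_dense (D i) /\ order_open (D i)) ->
  order_dense (\bigcap_(i in A) D i).
Proof.
move=> Ac AD p; have [[i0 Ai0]|A0] := pselect (A !=set0); last first.
  by exists p => // i Ai; case: A0; exists i.
have [f [fA fS]] := countable_enum Ai0 Ac.
(* The first component counts the stages, as the relation iterated here carries no index. *)
have [|u [u0 uS]] := @dependent_choice (nat * P)%type
    (fun x y => y.1 = x.1.+1 /\ D (f x.1) y.2 /\ y.2 <= x.2) (0%N, p).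
  by case=> n x /=; have [q Dq qx] := (AD _ (fA n)).1 x; exists (n.+1, q).
have u1 n : (u n).1 = n by elim: n => [|n IH]; [rewrite u0|rewrite (uS n).1 IH].
have [|q qu] := Pclosed (u := fun n => (u n).2) _; first by move=> n;
  case: (uS n) => _ [].
exists q; last by have := qu 0%N; rewrite u0.
move=> i Ai; have [n <-] := fS _ Ai; have [_ [Du _]] := uS n.
by rewrite u1 in Du; exact: (AD _ (fA n)).2 _ _ (qu n.+1) Du.
Qed.

Lemma chain_lower_bound (p0 : P) (F : omega1 -> P) a :
  (forall b c, c < b -> b < a -> F b <= F c) ->
  exists q, forall b, b < a -> q <= F b.
Proof.
move=> Fmono; have [[b0 b0a]|na] := pselect ([set b | b < a] !=set0); last first.
  by exists p0 => b ba; case: na; exists b.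
have [u [ua uS]] := countable_enum b0a (omega1_lt_countable a).
(* Running maxima turn the enumeration into an increasing sequence cofinal in the predecessors of
   [a]. *)
pose v := fix v n := if n is n'.+1 then Order.max (v n') (u n) else u 0%N.
have va n : v n < a by elim: n => [|n IH] /=; [exact: ua|rewrite gt_max IH;
  exact: ua].
have uv n : u n <= v n by case: n => //= n; rewrite le_max lexx orbT.
have Fle b c : c <= b -> b < a -> F b <= F c.
  by rewrite (le_eqVlt c) => /orP[/eqP->//|]; exact: Fmono.
have [|q qv] := Pclosed (u := F \o v) _; first by move=> n; apply: Fle;
  rewrite /= ?le_max ?lexx // (va n.+1).
exists q => b /uS[n <-]; exact: le_trans (qv n) (Fle _ _ (uv n) (va n)).
Qed.

End SigmaClosed.

(** * Names of partial functions *)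

Section Matrix.
Context (I M : Type) {d : Order.disp_t} {P : porderType d}.
Implicit Types C : I -> M -> set P.

(** [C a xi] plays the role of the set of conditions forcing [f a = xi], where
    [f] is a name of a partial function from [I] to [M]. *)
Definition partial_name C : Prop :=
  (forall a xi, order_open (C a xi)) /\
  (forall a xi xi' p, C a xi p -> C a xi' p -> xi = xi').

Definition undecided C (p : P) (a : I) : Prop :=
  forall xi, exists2 q, C a xi q & q <= p.

Definition collapsing C : Prop :=
  partial_name C /\ forall p, exists a, undecided C p a.

End Matrix.

(** Undecidedness at all large indices lets one index serve countably many conditions at once, as
    reduced powers require. *)
Definition tail_collapsing d (L : orderType d) M d' (P : porderType d')
    (C : L -> M -> set P) : Prop :=
  partial_name C /\ forall p, exists a, forall b, a <= b -> undecided C p b.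

(** * The dense tree of nodes *)

Section BaseTree.
Context {d : Order.disp_t} (P : porderType d) (M : Type).
Variables (p0 : P) (i : M -> P) (C : omega1 -> M -> set P).
Hypothesis Pclosed : sigma_closed P.
Hypothesis i_dense : forall p, exists m, i m <= p.
Hypothesis C_collapsing : collapsing C.

Let Copen a xi : order_open (C a xi) := C_collapsing.1.1 a xi.
Let Cinj := C_collapsing.1.2.

(** Conditions deciding whether [C a xi] holds for some [xi] and, if so,
    whether [i xi] is in the generic filter. *)
Let decides a : set P := [set q |
  (exists2 xi, C a xi q & q <= i xi \/ ~ compatible q (i xi)) \/
  (forall xi r, r <= q -> ~ C a xi r)].

Let decides_open a : order_open (decides a).
Proof.
move=> p q qp [[xi Cp H]|H]; [left|by right=> xi r rq; apply: H (le_trans rq qp)].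
exists xi; first exact: Copen Cp.
by case: H => H; [left; apply: le_trans H|right=> Hq; apply: H;
  apply: compatible_le Hq].
Qed.

Let decides_dense a : order_dense (decides a).
Proof.
move=> p; have [[xi [r rp Cr]]|H] := pselect (exists xi, exists2 r,
  r <= p & C a xi r).
  have [[s sr si]|H] := pselect (compatible r (i xi)); last by exists r => //;
    left; exists xi => //; right.
  by exists s; [left; exists xi; [apply: Copen Cr|left]|exact: le_trans rp].
by exists p => //; right=> xi r rp Cr; apply: H; exists xi, r.
Qed.

(** The values at an index undecided below [w0] give incompatible conditions, one for each element
    of [M]. A maximal antichain of [S] containing them has size at least [M], and at most [M] since
    [S] lies in the range of [i]; so [M] labels it bijectively. *)
Let splitting (W : set P) a : order_open W -> W !=set0 -> exists e : M -> P,
  [/\ forall xi, W (e xi), forall xi, decides a (e xi),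
      forall xi xi', compatible (e xi) (e xi') -> xi = xi' &
      forall w, W w -> exists xi, compatible w (e xi)].
Proof.
move=> Wo [w0 Ww0]; pose S := [set q | [/\ W q, decides a q & exists m, q = i m]].
have Sdense w : W w -> exists2 s, S s & s <= w.
  move=> Ww; have [q Dq qw] := decides_dense a w; have [m mq] := i_dense q.
  exists (i m); last exact: le_trans qw.
  by split; [apply: Wo Ww; apply: le_trans qw|apply: decides_open Dq|exists m].
have [a' Ha'] := C_collapsing.2 w0.
have /choice[s sP] : forall xi, exists s, S s /\ C a' xi s.
  move=> xi; have [q Cq qw] := Ha' xi; have [s Ss sq] := Sdense _ (Wo _ _ qw Ww0).
  have [s' Ss' s's] := Sdense q (Wo _ _ qw Ww0).
  by exists s'; split => //; apply: Copen Cq.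
have s_compat xi xi' : compatible (s xi) (s xi') -> xi = xi'.
  case=> r r1 r2.
  by apply: (Cinj (a := a') (p := r)); [apply: Copen r1 (sP xi).2|apply:
    Copen r2 (sP xi').2].
have [||A [sA AS Aa Amax]] := @maximal_antichain _ _ S (range s).
- by move=> _ [xi _ <-]; exact: (sP xi).1.
- by move=> _ _ [xi _ <-] [xi' _ <-] /s_compat ->.
have MA : [set: M] #= A.
  rewrite card_eq_le; apply/andP; split.
    apply: (inj_card_leq (f := s)) => [xi _|xi xi' _ _ E]; first by apply: sA;
      exists xi.
    by apply: s_compat; rewrite E; exists (s xi').
  apply: (@card_le_trans _ _ _ (range i)); last exact: card_image_le.
  by apply: subset_card_le => q /AS[_ _ [m ->]]; exists m.
have [e [eA eI eS]] := card_eq_bij p0 MA.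
exists e; split=> [xi|xi|xi xi' c|w Ww].
- by case: (AS _ (eA xi I)).
- by case: (AS _ (eA xi I)).
- by apply: eI => //; apply: Aa => //; apply: eA.
have [q Sq qw] := Sdense _ Ww; have [r Ar c] := Amax _ Sq.
have [xi _ E] := eS _ Ar; exists xi; rewrite E.
by apply: compatibleC; apply: compatible_le c.
Qed.

(** Branches are total functions [g], of which only the values up to [a] matter for [N a g]. The
    antichain is chosen from the set [below a g] alone, so branches with the same lower bounds share
    it. *)
Let nodes : exists N : omega1 -> (omega1 -> M) -> P,
  let below a g := [set q | forall b, b < a -> q <= N b g] in
  forall a, exists e : set P -> M -> P, forall g, N a g = e (below a g) (g a) /\
    forall W, order_open W -> W !=set0 ->
      [/\ forall xi, W (e W xi), forall xi, decides a (e W xi),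
      forall xi xi', compatible (e W xi) (e W xi') -> xi = xi' &
      forall w, W w -> exists xi, compatible w (e W xi)].
Proof.
have /choice[e eP] : forall x : omega1 * set P, exists e : M -> P,
    order_open x.2 -> x.2 !=set0 -> [/\ forall xi, x.2 (e xi), forall xi,
      decides x.1 (e xi),
      forall xi xi', compatible (e xi) (e xi') -> xi = xi' &
      forall w, x.2 w -> exists xi, compatible w (e xi)].
  case=> a W /=; have [[Wo W0]|nW] := pselect (order_open W /\ W !=set0).
    by have [e eP] := splitting a Wo W0; exists e.
  by exists (fun=> p0) => Wo W0; case: nW.
have [N NE] := wf_recursion omega1_wf (fun=> p0 : P)
  (fun a F g => e (a, [set q | forall b, b < a -> q <= F b g]) (g a)).
exists N => below a; exists (fun W => e (a, W)) => g; split; last first.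
  by move=> W Wo W0; apply: (eP (a, W)).
rewrite NE; congr (e (a, _) _); apply/seteqP.
by split=> q H b ba; have := H b ba; case: asboolP.
Qed.

Let N := projT1 (cid nodes).
Let below a g : set P := [set q | forall b, b < a -> q <= N b g].
Let eprop := projT2 (cid nodes).
Let e a := projT1 (cid (eprop a)).

Let NE a g : N a g = e a (below a g) (g a).
Proof. by have := projT2 (cid (eprop a)) g; case. Qed.

Let eP a W : order_open W -> W !=set0 ->
  [/\ forall xi, W (e a W xi), forall xi, decides a (e a W xi),
      forall xi xi', compatible (e a W xi) (e a W xi') -> xi = xi' &
      forall w, W w -> exists xi, compatible w (e a W xi)].
Proof.
have [m _] := i_dense p0.
by have := projT2 (cid (eprop a)) (fun=> m); case=> _; apply.
Qed.

Let below_open a g : order_open (below a g).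
Proof. by move=> p q qp H b /H; apply: le_trans. Qed.

Let node_ext a g g' : (forall b, b <= a -> g b = g' b) -> N a g = N a g'.
Proof.
elim/(well_founded_ind omega1_wf): a => a IH gg'; rewrite !NE gg' //.
congr (e _ _ _); apply/seteqP.
by split=> q H b ba; have := H b ba; rewrite (IH b) // => c cb;
  apply: gg'; apply: le_trans cb (ltW ba).
Qed.

Let below_ext a g g' : (forall b, b < a -> g b = g' b) -> below a g = below a g'.
Proof.
move=> gg'; apply/seteqP.
by split=> q H b ba; have := H b ba; rewrite (@node_ext b g g') // => c cb;
  apply: gg'; apply: le_lt_trans ba.
Qed.

Let below_neq0 a g : below a g !=set0.
Proof.
elim/(well_founded_ind omega1_wf): a => a IH.
apply: (@chain_lower_bound _ P Pclosed p0 (fun b => N b g)) => b c cb ba.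
have [+ _ _ _] := eP b (@below_open b g) (IH b ba).
by move=> /(_ (g b)); rewrite -NE; apply.
Qed.

Let node_below a g : below a g (N a g).
Proof. by rewrite NE; have [+ _ _ _] := eP a (@below_open a g) (@below_neq0 a g).
  Qed.

Let node_le a b g : b <= a -> N a g <= N b g.
Proof. by rewrite (le_eqVlt b) => /orP[/eqP->//|]; apply: node_below. Qed.

(** Agreement before [b] gives both branches the same antichain at [b], whose compatible members
    carry the same label. *)
Let node_compat a a' g g' : compatible (N a g) (N a' g') ->
  forall b, b <= a -> b <= a' -> g b = g' b.
Proof.
move=> c; apply: (well_founded_ind omega1_wf) => b IH ba ba'.
have E : below b g = below b g'.
  by apply: below_ext => x xb; apply: IH => //; apply: le_trans (ltW xb) _.
have [_ _ + _] := eP b (@below_open b g) (@below_neq0 b g).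
apply; rewrite {2}E -!NE; apply: compatible_le c; exact: node_le.
Qed.

(** Distributivity gives one [q] below a node of every earlier level. These nodes fit into a single
    branch, and the antichain below that branch meets [q]. *)
Let level_dense a p : exists g, compatible p (N a g).
Proof.
elim/(well_founded_ind omega1_wf): a p => a IH p.
have [|q Dq qp] := @sigma_distributive _ P Pclosed _ [set b | b < a]
    (fun b => [set q | exists g, q <= N b g]) (omega1_lt_countable a) _ p.
  move=> b /IH Db; split=> [x|x y yx [g xg]]; last by exists g; apply: le_trans xg.
  by have [g [r rx rN]] := Db x; exists r => //; exists g.
have [m _] := i_dense p0.
have /choice[G GP] : forall b, exists g, b < a -> q <= N b g.
  move=> b; have [ba|nb] := pselect (b < a); last by exists (fun=> m).
  by have [g qg] := Dq b ba; exists g.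
(* All nodes chosen by the [G b] lie above [q], so the [G b] agree where they overlap and the
   diagonal follows each of them. *)
pose g b := G b b.
have qg : below a g q.
  move=> b ba; rewrite (@node_ext b g (G b)) ?GP // => x xb.
  have xa := le_lt_trans xb ba.
  by apply: (@node_compat x b (G x) (G b)) => //; exists q; apply: GP.
have [_ _ _ /(_ _ qg)[xi c]] := eP a (@below_open a g) (@below_neq0 a g).
exists (fun x => if x == a then xi else g x); rewrite NE eqxx.
rewrite (@below_ext a _ g) => [|b ba]; last by rewrite lt_eqF.
exact: compatible_le c.
Qed.

(** Take [i m] below [p], an index [a] undecided below [i m], and [q] below [i m] forcing the value
    [m] there. A node at level [a] compatible with [q] decides the value, which must be [m], and
    decides [i m]; so it lies below [i m]. *)
Let node_dense p : exists a g, N a g <= p.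
Proof.
have [m mp] := i_dense p; have [a Ha] := C_collapsing.2 (i m).
have [q Cq qm] := Ha m; have [g [r rq rN]] := level_dense a q.
exists a, g; apply: le_trans mp.
have Cr := Copen rq Cq.
have [_ + _ _] := eP a (@below_open a g) (@below_neq0 a g).
move=> /(_ (g a)); rewrite -NE => -[[xi CN]|H]; last by case: (H m r).
have -> : m = xi by apply: (Cinj Cr); apply: Copen CN.
case=> // H; case: H; exists r => //.
have -> : xi = m by apply: (Cinj _ Cr); apply: Copen CN.
exact: le_trans qm.
Qed.

Lemma collapse_iso : regular_open P ≅ Col omega1 M.
Proof.
have [m _] := i_dense p0.
(* Past the domain of [t] the branch is filled with a default label, which the nodes indexed by the
   domain do not see. *)
pose ext (t : tree omega1 M) x := odflt m (t x).
pose W (t : tree omega1 M) : set P := [set p | forall b, t b -> p <= N b (ext t)].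
have tle (s t : tree omega1 M) b : s <= t -> t b -> s b = t b.
  by move=> /asboolP st; case E: (t b) => [k|//] _; apply: st.
have tdom (t : tree omega1 M) b c : t b -> c <= b -> t c.
  by case: t => /= t [a ta]; rewrite !ta => ba cb; apply: le_lt_trans ba.
have twk (s t : tree omega1 M) b : s <= t -> t b -> N b (ext s) = N b (ext t).
  by move=> st tb; apply: node_ext => c cb; rewrite /ext (tle s t) //;
    apply: tdom cb.
apply: (@regular_open_iso _ _ _ _ W) => [t|t p q qp Wp b tb|s t st p Wp b tb|s t [p
  [Ws Wt]]|p].
- have [a ta] : exists a, forall x, isSome (t x) = (x < a) by case: t.
  have [q qa] := @below_neq0 a (ext t).
  by exists q => b; rewrite ta; apply: qa.
- exact: le_trans (Wp b tb).
- by rewrite -(twk s t) //; apply: Wp; rewrite (tle s t).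
- have agree x : s x -> t x -> s x = t x.
    move=> sx tx; have := @node_compat x x (ext s) (ext t) _ x (lexx x) (lexx x).
    rewrite /ext; case: (s x) sx (Ws x sx) => // k _ ps;
      case: (t x) tx (Wt x tx) => // k' _ pt.
    by move=> /= H; rewrite H //; exists p.
  have [sa sP] : exists a, forall x, isSome (s x) = (x < a) by case: (s).
  have [ta tP] : exists a, forall x, isSome (t x) = (x < a) by case: (t).
  have [le|/ltW le] := leP sa ta.
    exists t => //; apply/asboolP => x k sx.
    by rewrite -agree ?sx // tP; apply: lt_le_trans le; rewrite -sP sx.
  exists s => //; apply/asboolP => x k tx.
  by rewrite agree ?tx // sP; apply: lt_le_trans le; rewrite -tP tx.
(* The length [a'] exceeds [a], so that [a] is in the domain and the conditions in [W] lie below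
   [N a g]. *)
have [a [g gp]] := node_dense p; have [a' /(_ 0%N) aa'] := omega1_bounded (fun=> a).
have tP : exists a, forall x, isSome (if x < a' then Some (g x) else None) = (x <
  a).
  by exists a' => x; case: ifP.
exists (Tree tP) => q /(_ a); rewrite /= aa' => /(_ isT) qN; apply: le_trans gp.
rewrite (@node_ext a g (ext (Tree tP))) // => x xa.
by rewrite /ext /= (le_lt_trans xa).
Qed.

(** The new name reads off the label of the generic branch at [a]. If [N a g] lies below [p], the
    levels above [a] are still free, as [g] may be altered there. *)
Lemma tail_collapsing_nodes :
  exists C' : omega1 -> M -> set P, tail_collapsing C'.
Proof.
exists (fun a xi => [set q | exists g, g a = xi /\ q <= N a g]).
split=> [|p].
  split=> [a xi p q qp [g [ga pN]]|a xi xi' p [g [<- pg]] [g' [<- pg']]].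
    by exists g; split=> //; apply: le_trans pN.
  by apply: (@node_compat a a) => //; exists p.
have [a [g gp]] := node_dense p; have [a' /(_ 0%N) aa'] := omega1_bounded (fun=> a).
exists a' => b a'b xi; have ab := lt_le_trans aa' a'b.
pose g' x := if x == b then xi else g x.
exists (N b g'); first by exists g'; rewrite /g' eqxx.
apply: le_trans gp; rewrite (@node_ext a g g') => [|x xa].
  exact: node_le (ltW ab).
by rewrite /g' lt_eqF // (le_lt_trans xa).
Qed.

End BaseTree.

(** * Reduced powers *)

Definition unbounded (S : set nat) : Prop := forall N, exists2 n, (N <= n)%N & S n.

Definition almost_sub (S T : set nat) : Prop :=
  exists N, forall n, (N <= n)%N -> S n -> T n.

Section ReducedPowers.
Context {d : Order.disp_t} {B : ctbDistrLatticeType d}.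
Implicit Types b c : nat -> B.

Local Notation rpi b := (ba_pi d (frechet_congr B) b : rp B).

Lemma nearooP (Q : nat -> Prop) :
  (\forall n \near \oo, Q n) <-> exists N, forall n, (N <= n)%N -> Q n.
Proof. by split=> [[N _ NQ]|[N NQ]]; exists N => // n /NQ. Qed.

Lemma rp_eqP b c : rpi b = rpi c <-> exists N, forall n, (N <= n)%N -> b n = c n.
Proof.
split=> [/ba_piP/asboolP/nearooP//|H].
by apply/ba_piP/asboolP/nearooP.
Qed.

Lemma rp_leP b c : rpi b <= rpi c <-> exists N, forall n, (N <= n)%N -> b n <= c n.
Proof. by rewrite rp_le; split=> [/asboolP/nearooP|H];
  last exact/asboolP/nearooP. Qed.

Lemma rp_surj (x : rp B) : exists b, x = rpi b.
Proof. by elim/ba_quotW: x => b; exists b. Qed.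

Lemma rp_neq0P b : rpi b != \bot <-> unbounded [set n | b n != \bot].
Proof.
rewrite -[\bot]/(rpi (fun=> \bot)); split=> [/eqP H N|H].
  apply: contrapT => nN; apply: H; apply/rp_eqP; exists N => n Nn.
  by apply/eqP/negP => /negP b0; apply: nN; exists n.
apply/eqP => /rp_eqP[N HN]; have [n Nn /eqP] := H N; apply; exact: HN.
Qed.

Lemma nonzero_le (p q : nonzero B) : (p <= q) = ((p : B) <= (q : B)).
Proof. by []. Qed.

Lemma nz_neq0 (p : nonzero B) : (p : B) != \bot.
Proof. by case: p. Qed.

Lemma nonzero_inj (p q : nonzero B) : (p : B) = q -> p = q.
Proof.
by case: p q => [x hx] [y hy] /= E; subst y; congr Nonzero; apply: bool_irrelevance.
Qed.

End ReducedPowers.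

Section ReducedPowerForcing.
Context {d : Order.disp_t} (B : ctbDistrLatticeType d).
Implicit Types b c : nat -> B.

Local Notation rpi b := (ba_pi d (frechet_congr B) b : rp B).

(** Diagonalisation: [c] takes the value of [b n] at a position [k n] past the thresholds of all
    earlier comparisons, and vanishes off these positions. *)
Lemma rp_sigma_closed : sigma_closed (nonzero (rp B)).
Proof.
move=> u uS.
have /choice[b bP] : forall n, exists b, (u n : rp B) = rpi b by move=> n;
  exact: rp_surj.
have /choice[N NP] : forall n, exists N, forall k, (N <= k)%N -> b n.+1 k <= b n k.
  by move=> n; apply/rp_leP; rewrite -!bP; exact: uS.
have b0 n : unbounded [set k | b n k != \bot] by apply/rp_neq0P; rewrite -bP;
  exact: nz_neq0.
have [k0 _ bk0] := b0 0%N 0%N.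
have [|v [v0 vS]] := @dependent_choice (nat * nat)%type
   (fun x y => [/\ y.1 = x.1.+1, (x.2 < y.2)%N, forall j,
     (j <= x.1)%N -> (N j <= y.2)%N &
      b y.1 y.2 != \bot]) (0%N, k0).
  case=> n k; have [m nm bm] := b0 n.+1 (k.+1 + \sum_(j < n.+1) N j)%N.
  exists (n.+1, m); split=> //=; first by apply: leq_trans nm; apply: leq_addr.
  move=> j jn; apply: leq_trans nm; apply: leq_trans (leq_addl _ _).
  by rewrite (bigD1 (Ordinal (jn : j < n.+1)%N)) //= leq_addr.
pose k n := (v n).2.
have v1 n : (v n).1 = n by elim: n => [|n IH]; [rewrite v0|case: (vS n) => ->;
  rewrite IH].
have klt : {homo k : m n / (m < n)%N}.
  by apply: homo_ltn => [x y z|n]; [exact: ltn_trans|case: (vS n)].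
have kinj : injective k.
  by move=> m n E; case: (ltngtP m n) => // /klt; rewrite E ltnn.
have kN n j : (j < n)%N -> (N j <= k n)%N.
  by case: n => // n; case: (vS n) => _ _ + _; rewrite v1; apply.
have bk n : b n (k n) != \bot.
  by case: n => [|n]; [rewrite /k v0|case: (vS n) => _ _ _; rewrite v1].
have /choice[c cP] : forall x, exists y : B, (forall n, k n = x -> y = b n x) /\
     ((forall n, k n <> x) -> y = \bot).
  move=> x; have [[n kn]|nx] := pselect (exists n, k n = x).
    by exists (b n x); split=> [m km|/(_ n)//]; congr b; apply: kinj; rewrite km.
  by exists \bot; split=> // n kn; case: nx; exists n.
have c0 : rpi c != \bot.
  apply/rp_neq0P => m; exists (k m); last by rewrite /= ((cP (k m)).1 m erefl).
  by elim: m => // m /leq_ltn_trans; apply; exact: klt.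
exists (Nonzero c0) => n; rewrite nonzero_le /= bP; apply/rp_leP.
exists (k n) => x nx; have [[m kx]|nk] := pselect (exists m, k m = x); last first.
  by rewrite (cP x).2 ?le0x // => m km; apply: nk; exists m.
have nm : (n <= m)%N by rewrite leqNgt; apply/negP => /klt; rewrite kx ltnNge nx.
rewrite ((cP x).1 _ kx) -kx.
have chain l : (n <= l)%N -> forall y, (forall j,
  (j < l)%N -> (N j <= y)%N) -> b l y <= b n y.
  elim: l => [|l IH]; first by rewrite leqn0 => /eqP->.
  rewrite leq_eqVlt => /orP[/eqP->//|nl] y yN.
  apply: (@le_trans _ _ (b l y)); first by apply: NP; apply: yN.
  by apply: IH => // j jl; apply: yN; apply: ltnW.
by apply: chain => // j; apply: kN.
Qed.

(** As [s] maps [M] onto the sequences in [M], one element of [M] describes a choice from [i] at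
    every coordinate. *)
Lemma rp_dense (M : Type) (i : M -> nonzero B) (s : M -> nat -> M) (p0 :
  nonzero B) :
  (exists m0 m1 : M, m0 <> m1) -> (forall f, exists m, s m = f) ->
  (forall p, exists m, i m <= p) ->
  exists i' : M -> nonzero (rp B), forall p, exists m, i' m <= p.
Proof.
move=> [m0 [m1 m01]] sS iD.
(* A pair of distinct entries of [s m] codes the value [\bot], which [i] omits. *)
pose c m n : B := if `[< s m n.*2 = s m n.*2.+1 >] then (i (s m n.*2) :
  B) else \bot.
have t0 : rpi (fun=> p0 : B) != \bot.
  by apply/rp_neq0P => N; exists N => //=; exact: nz_neq0.
exists (fun m => if pselect (rpi (c m) != \bot) is left h then Nonzero h else
  Nonzero t0).
move=> p; have [b pb] := rp_surj p.
have /choice[g gP] : forall n, exists m, b n != \bot -> (i m : B) <= b n.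
  move=> n; have [h|h] := pselect (is_true (b n != \bot)); last by exists m0 => /h.
  by have [m] := iD (Nonzero h); exists m.
have [m sm] := sS (fun k => if b k./2 == \bot then if odd k then m1 else m0 else g
  k./2).
have cE n : c m n = if b n == \bot then \bot else (i (g n) : B).
  rewrite /c sm -[n.*2.+1]/(true + n.*2)%N half_bit_double doubleK oddD odd_double
    /=.
  by case: (eqVneq (b n) \bot) => _; [rewrite (asboolF m01)|rewrite asboolT].
have cb n : c m n <= b n.
  by rewrite cE; case: (eqVneq (b n) \bot) => [_|/gP//]; apply: le0x.
exists m; case: pselect => [h|nh]; first by rewrite nonzero_le /= pb; apply/rp_leP;
  exists 0%N.
case: nh; apply/rp_neq0P => N; have /rp_neq0P /(_ N)[n Nn bn] : rpi b != \bot.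
  by rewrite -pb; exact: nz_neq0.
by exists n => //=; rewrite cE (negbTE bn); exact: nz_neq0.
Qed.

(** [E a g S] says that [S] forces [a] to name [g]. The value at [a] is [xi] when the support of [b]
    makes [a] name some [g] and every nonzero coordinate forces [xi] at [g]. For density, one [g0]
    bounds the thresholds of all coordinates; the support shrinks to a [T] naming some [g] above
    [g0], and each coordinate in [T] is refined. *)
Lemma rp_collapsing d' (L : orderType d') (M : Type) (C : L -> M -> set (nonzero B))
    (E : omega1 -> L -> set (set nat)) :
  (forall u : nat -> L, exists a, forall n, u n < a) ->
  tail_collapsing C ->
  (forall a g S T, almost_sub T S -> E a g S -> E a g T) ->
  (forall a g g' S, unbounded S -> E a g S -> E a g' S -> g = g') ->
  (forall S g0, unbounded S -> exists a g, g0 <= g /\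
     exists T, [/\ unbounded T, T `<=` S & E a g T]) ->
  exists C' : omega1 -> M -> set (nonzero (rp B)), collapsing C'.
Proof.
move=> Lb [[Co Ci] Ct] Eo Ei Ed.
exists (fun a xi => [set p : nonzero (rp B) | exists b g, [/\ (p : rp B) = rpi b,
   E a g [set n | b n != \bot] & forall n (h : b n != \bot), C g xi (Nonzero h)]]).
split; first split.
- move=> a xi p q qp [b [g [pb Eb Cb]]]; have [c qc] := rp_surj q.
  have /rp_leP[N Nb] : rpi c <= rpi b by rewrite -pb -qc.
  have cb0 n : c n `&` b n != \bot -> b n != \bot.
    by apply: contra => /eqP ->; rewrite meetx0.
  (* Meeting with [b] puts every coordinate, not just almost every one, below that of [b]. *)
  exists (fun n => c n `&` b n), g; split.
  - rewrite qc; apply/rp_eqP; exists N => n /Nb.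
    by rewrite leEmeet => /eqP.
  - by apply: Eo Eb; exists 0%N => n _ /cb0.
  - move=> n h; apply: (Co _ _ _ _ _ (Cb n (cb0 _ h))); rewrite nonzero_le /=;
    exact: leIr.
- move=> a xi xi' p [b [g [pb Eb Cb]]] [c [g' [pc Ec Cc]]].
  have b0 : unbounded [set n | b n != \bot] by apply/rp_neq0P; rewrite -pb;
    exact: nz_neq0.
  have /rp_eqP[N bc] : rpi b = rpi c by rewrite -pb -pc.
  have gg' : g = g'.
    apply: (Ei a g g' _ b0 Eb); apply: Eo Ec.
    by exists N => n /bc /= ->.
  subst g'; have [n Nn bn] := b0 N; have cn : c n != \bot by rewrite -bc.
  apply: (Ci g _ _ (Nonzero bn)) => //.
  suff -> : Nonzero bn = Nonzero cn by [].
  by apply: nonzero_inj; rewrite /= bc.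
move=> p; have [b pb] := rp_surj p.
have b0 : unbounded [set n | b n != \bot] by apply/rp_neq0P; rewrite -pb;
  exact: nz_neq0.
have [n0 _ bn0] := b0 0%N; have [l0 _] := Ct (Nonzero bn0).
have /choice[u uP] : forall n, exists a, forall h : b n != \bot,
    forall g, a <= g -> undecided C (Nonzero h) g.
  move=> n; have [h|nh] := pselect (is_true (b n != \bot)); last by exists l0.
  have [a aP] := Ct (Nonzero h); exists a => h' g ag.
  by have -> : Nonzero h' = Nonzero h by [apply: nonzero_inj]; apply: aP.
have [g0 g0P] := Lb u; have [a [g [g0g [T [T0 TS ET]]]]] := Ed _ g0 b0.
exists a => xi.
have /choice[c cP] : forall n, exists y : B, (~ T n -> y = \bot) /\
    (T n -> y <= b n /\ exists h : y != \bot, C g xi (Nonzero h)).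
  move=> n; have [Tn|nT] := pselect (T n); last by exists \bot.
  have [q Cq qb] := uP n (TS _ Tn) g (le_trans (ltW (g0P n)) g0g) xi.
  exists q; split=> // _; split=> //; exists (nz_neq0 q).
  by have -> : Nonzero (nz_neq0 q) = q by [apply: nonzero_inj].
have cT n : c n != \bot -> T n.
  by move=> /eqP h; apply: contrapT => /(cP n).1.
have Tc n : T n -> c n != \bot by move=> /(cP n).2[_ []].
have c0 : rpi c != \bot.
  by apply/rp_neq0P => N; have [n Nn /Tc cn] := T0 N; exists n.
exists (Nonzero c0).
  exists c, g; split=> //; first by apply: Eo ET; exists 0%N => n _ /cT.
  move=> n h; have [_ [h' Ch]] := (cP n).2 (cT n h).
  by have -> : Nonzero h = Nonzero h' by [apply: nonzero_inj].
rewrite nonzero_le /= pb; apply/rp_leP; exists 0%N => n _.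
have [Tn|/(cP n).1->] := pselect (T n); last exact: le0x.
by have [] := (cP n).2 Tn.
Qed.

End ReducedPowerForcing.

(** * The tree of sequences *)

(** An infinite cardinal absorbs the factor [omega]. Zorn's lemma covers [A] by disjoint injective
    sequences up to a finite remainder [R], and pairing the positions makes room for countably many
    copies. *)
Lemma infinite_absorb T (A : set T) : infinite_set A ->
  exists f : nat -> T -> T, (forall n x, A x -> A (f n x)) /\
    (forall n m x y, A x -> A y -> f n x = f m y -> n = m /\ x = y).
Proof.
move=> Ainf.
pose good (F : set (nat -> T)) :=
  (forall g n, F g -> A (g n)) /\
  (forall g h n m, F g -> F h -> g n = h m -> g = h /\ n = m).
have [|F [[FA FI] Fmax]] := @Zorn_bigcup _ good.
  move=> G Ggood Gtot; split=> [g n [X GX Xg]|g h n m [X GX Xg] [Y GY Yh]].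
    exact: (Ggood X GX).1.
  case: (Gtot _ _ GX GY) => [XY|YX].
    exact: (Ggood Y GY).2 _ _ _ _ (XY _ Xg) Yh.
  exact: (Ggood X GX).2 _ _ _ _ Xg (YX _ Yh).
pose R := [set x | A x /\ forall g n, F g -> g n <> x].
have Rfin : finite_set R.
  apply: contrapT => /infiniteP NR.
  have [[x0 Ax0]|A0] := pselect (A !=set0); last first.
    by apply: Ainf; suff -> : A = set0 by []; apply/seteqP; split=> // x Ax;
      apply: A0; exists x.
  have [r [rR rI]] := card_leq_inj x0 NR.
  have nFr : ~ F r by move=> Fr; have [_ /(_ r 0%N Fr)] := rR 0%N I.
  apply: (Fmax (F `|` [set r])).
    by split=> [g Fg|sub]; [left|apply: nFr; apply: sub; right].
  split=> [g n [/FA//|->]|g h n m]; first by case: (rR n I).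
  move=> [Fg|->] [Fh|->].
  - exact: FI.
  - by move=> E; have [_ /(_ g n Fg)] := rR m I.
  - by move=> /esym E; have [_ /(_ h m Fh)] := rR n I.
  - by move=> /rI ->.
have [g0 Fg0] : F !=set0.
  apply: contrapT => F0; apply: Ainf; suff -> : A = R by [].
  apply/seteqP; split=> x; last by case.
  by move=> Ax; split=> // g n Fg; case: F0; exists g.
have /countable_injP[rho rhoI] := finite_set_countable Rfin.
(* Elements of the sequences get even positions, those of [R] odd positions in the sequence [g0]. *)
have /choice[k kP] : forall x, exists k : (nat -> T) * nat, A x -> F k.1 /\
    ((exists2 n, k.1 n = x & k.2 = n.*2) \/ [/\ R x,
      k.1 = g0 & k.2 = (rho x).*2.+1]).
  move=> x; have [[g [n [Fg gn]]]|nx] := pselect (exists g n, F g /\ g n = x).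
    by exists (g, n.*2) => _; split=> //; left; exists n.
  exists (g0, (rho x).*2.+1) => Ax; split=> //; right; split=> //.
  by split=> // g n Fg gn; apply: nx; exists g, n.
have kI x y : A x -> A y -> k x = k y -> x = y.
  move=> Ax Ay E; have [Fx Hx] := kP x Ax; have [Fy Hy] := kP y Ay.
  move: Hx Hy; rewrite E => -[[n kn kx]|[Rx _ kx]] [[m km ky]|[Ry _ ky]];
    move: kx; rewrite ky.
  - by move=> /double_inj nm; rewrite -kn -nm km.
  - by move=> /(congr1 odd); rewrite /= !odd_double.
  - by move=> /(congr1 odd); rewrite /= !odd_double.
  - by move=> [] /double_inj /esym; apply: rhoI; apply: mem_set.
exists (fun n x => (k x).1 (choice.pickle (n, (k x).2)));
  split=> [n x Ax|n m x y Ax Ay E].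
  exact: FA (kP x Ax).1.
have [E1 /(pcan_inj choice.pickleK)[-> E2]] := FI _ _ _ _ (kP x Ax).1 (kP y Ay).1 E.
by split=> //; apply: kI => //; rewrite [k x]surjective_pairing E1 E2
  -surjective_pairing.
Qed.

Section TreeCardinals.
Context {d : Order.disp_t} (L : orderType d) (K : Type) (l0 : L) (k0 k1 : K).
Hypothesis Lbounded : forall u : nat -> L, exists a, forall n, u n < a.
Hypothesis k01 : k0 <> k1.

Lemma tree_domain (t : tree L K) : exists a, forall x, isSome (t x) = (x < a).
Proof. by case: t. Qed.

Lemma tree_of (v : L -> K) (a : L) :
  exists t : tree L K, forall x, t x = if x < a then Some (v x) else None.
Proof.
have tP : exists b, forall x, isSome (if x < a then Some (v x) else None) = (x < b).
  by exists a => x; case: ifP.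
by exists (Tree tP).
Qed.

Lemma tree_inj (s t : tree L K) : (forall x, s x = t x) -> s = t.
Proof.
by move=> st; apply: le_anti; apply/andP; split; apply/asboolP => x k; rewrite st.
Qed.

Lemma segment_inj (a b : L) : (forall x, (x < a) = (x < b)) -> a = b.
Proof.
by move=> ab; apply: le_anti; rewrite !leNgt (ab b) -(ab a) !ltxx.
Qed.

Lemma infinite_segment : exists c, forall a, c <= a -> infinite_set [set x :
  L | x < a].
Proof.
have [|u [_ uS]] := @dependent_choice L (fun x y => x < y) l0.
  by move=> x; have [y /(_ 0%N) xy] := Lbounded (fun=> x); exists y.
have [c uc] := Lbounded u; exists c => a ca; apply/infiniteP.
have ulo : {homo u : m n / (m < n)%N >-> m < n} by apply: homo_ltn => // x y z;
  apply: lt_trans.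
apply: (inj_card_leq (f := u)) => [n _|m n _ _ E]; first exact: lt_le_trans ca.
by case: (ltngtP m n) => // /ulo; rewrite E ltxx.
Qed.

(** Countably many nodes have a common bound [a] on their lengths, and an infinite segment has room
    to write them all in one node of length [a]. [s] is a left inverse of this coding. *)
Lemma tree_sequences : exists s : tree L K -> nat -> tree L K, forall f, exists t,
  s t = f.
Proof.
have /choice[j jP] : forall a : L, exists j : nat -> L -> L, infinite_set [set x :
  L | x < a] ->
    (forall n x, x < a -> j n x < a) /\
    (forall n m x y, x < a -> y < a -> j n x = j m y -> n = m /\ x = y).
  move=> a; have [inf|fin] := pselect (infinite_set [set x : L | x < a]).
    by have [j jP] := infinite_absorb inf; exists j.
  by exists (fun=> id).
(* Two symbols per place: [Some k] is written [k], [k], and [None] is written [k0], [k1]. *)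
pose code (b : bool) (o : option K) := if o is Some k then k else if b then k1 else
  k0.
have codeI o o' : (forall b, code b o = code b o') -> o = o'.
  case: o o' => [k|] [k'|] //= H.
  - by rewrite (H true).
  - by case: k01; rewrite -(H true) -(H false).
  - by case: k01; rewrite (H true) (H false).
have /choice[c cP] : forall f : nat -> tree L K, exists t : tree L K, exists a,
    [/\ forall x, isSome (t x) = (x < a), infinite_set [set x : L | x < a],
        forall n x, f n x -> x < a &
        forall n (b : bool) x, x < a -> t (j a (b + n.*2)%N x) = Some (code b (f n
          x))].
  move=> f; have /choice[l lP] := fun n => tree_domain (f n).
  have [c cinf] := infinite_segment; have [b lb] := Lbounded l.
  pose a := Order.max b c; have ca : c <= a by rewrite le_max lexx orbT.
  have ainf := cinf _ ca; have [ja jI] := jP a ainf.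
  have /choice[v vP] : forall z, exists k, forall n (b : bool) x, x < a ->
      j a (b + n.*2)%N x = z -> k = code b (f n x).
    move=> z; have [[n [e [x [xa jz]]]]|nz] :=
      pselect (exists n (e : bool) x, x < a /\ j a (e + n.*2)%N x = z).
      exists (code e (f n x)) => n' e' x' xa' jz'.
      have [E <-] := jI _ _ _ _ xa xa' (etrans jz (esym jz')).
      have -> : e = e' by move: (congr1 odd E); rewrite !oddD !odd_double !addbF;
        case: (e) (e') => -[].
      by have -> : n = n' by move: (congr1 half E); rewrite !half_bit_double.
    by exists k0 => n e x xa jz; case: nz; exists n, e, x.
  have [t tP] := tree_of v a; exists t, a; split=> //.
  - by move=> x; rewrite tP; case: ifP.
  - move=> n x; rewrite lP => xl; apply: lt_trans xl _; apply: lt_le_trans (lb n) _.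
    by rewrite le_max lexx.
  - by move=> n e x xa; rewrite tP ja //; congr Some; apply: vP xa _.
have cI f f' : c f = c f' -> f = f'.
  move=> E; have [a [aD ainf fa fP]] := cP f; have [a' [aD' _ fa' fP']] := cP f'.
  have aa' : a = a' by apply: segment_inj => x; rewrite -aD -aD' E.
  subst a'; apply/funext => n; apply: tree_inj => x.
  have [xa|nxa] := pselect (is_true (x < a)); last first.
    have := fa n x; have := fa' n x.
    by case: (f n x) => [?|]; case: (f' n x) => [?|] // H1 H2; case: nxa; auto.
  by apply: codeI => b; have := fP n b x xa; rewrite E fP' // => -[].
have /choice[s sP] : forall t, exists f, forall f', c f' = t -> f' = f.
  move=> t; have [[f <-]|nf] := pselect (exists f, c f = t).
    by exists f => f' /cI.
  by exists (fun=> t) => f' E; case: nf; exists f'.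
by exists s => f; exists (c f); apply/esym/sP.
Qed.

Hypothesis Lcard : is_cardinal L.

(** Were the tail that small, [L] would embed into the segment below a suitable [m], since an
    infinite segment absorbs two copies of itself. *)
Let tail_not_le (y a : L) : ~ ([set z : L | y < z] #<= [set x | x < a]).
Proof.
move=> le; have [c cinf] := infinite_segment.
have [y' /(_ 0%N) yy'] := Lbounded (fun=> y).
pose m := Order.max c (Order.max a y').
have cm : c <= m by rewrite le_max lexx.
have am : a <= m by rewrite !le_max lexx !orbT.
have ym : y < m by rewrite !lt_max yy' !orbT.
have [f [fm fI]] := infinite_absorb (cinf _ cm).
have [g [ga gI]] := card_leq_inj y le.
apply: (Lcard.2 m).
apply: (inj_card_leq (f := fun z => if y < z then f 1%N (g z) else f 0%N z)) =>
  [z _|z z' _ _].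
  case: ltP => yz; apply: fm => /=; last exact: le_lt_trans ym.
  by apply: lt_le_trans am; apply: ga.
have gm w : y < w -> g w < m by move=> yw; apply: lt_le_trans am; apply: ga.
by case: ltP => yz; case: ltP => yz' E; have [] := fI _ _ _ _ _ _ E => //=;
  rewrite ?gm ?(le_lt_trans _ ym) // => _; apply: gI.
Qed.

(** [s y x] is the ordinal [y + 1 + x]. *)
Lemma ordinal_shift : exists s : L -> L -> L,
  (forall y x, y < s y x) /\ (forall y x x', x < x' -> s y x < s y x').
Proof.
suff /choice[s sP] : forall y, exists s : L -> L,
    (forall x, y < s x) /\ (forall x x', x < x' -> s x < s x').
  by exists s; split=> y; case: (sP y).
move=> y.
have /choice[least leastP] : forall A : set L, exists z,
  A !=set0 -> A z /\ forall z', A z' -> z <= z'.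
  move=> A; have [A0|A0] := pselect (A !=set0); last by exists y.
  have [z Az zmin] := wf_minimal Lcard.1 A0; exists z => _; split=> // z' Az'.
  by rewrite leNgt; apply/negP => /zmin.
have [s sE] := wf_recursion Lcard.1 y
  (fun x F => least [set z | y < z /\ forall x', x' < x -> F x' <> z]).
pose A x := [set z | y < z /\ forall x', x' < x -> s x' <> z].
have {}sE x : s x = least (A x).
  rewrite sE; congr least; apply/seteqP.
  by split=> z [yz H]; split=> // x' xx'; have := H x' xx'; case: asboolP.
(* Otherwise [s] would map the predecessors of [x] onto the whole tail after [y]. *)
have A0 x : A x !=set0.
  apply: contrapT => nA; apply: (@tail_not_le y x).
  apply: (card_le_trans _ (card_image_le s _)); apply: subset_card_le => z yz.
  apply: contrapT => nz; apply: nA; exists z; split=> // x' xx' sz.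
  by apply: nz; exists x'.
have sA x : A x (s x) by rewrite sE; case: (leastP _ (A0 x)).
exists s; split=> [x|x x' xx']; first by case: (sA x).
have [_ /(_ x xx') /eqP ne] := sA x'; rewrite lt_neqAle ne /= sE.
by apply: (leastP _ (A0 x)).2; case: (sA x') => yx' H; split=> // w wx; apply: H;
  apply: lt_trans xx'.
Qed.

(* The condition [t] codes the sequence [xi] of length [a] at [b]: from [b + 1]
   on it consists of [a] symbols [k0] and one symbol [k1], followed by [xi]. *)
Lemma tree_tail_collapsing : exists C : L -> tree L K -> set (tree L K),
  tail_collapsing C.
Proof.
have [s [s_gt s_lt]] := ordinal_shift.
have /choice[len lenP] := fun xi : tree L K => tree_domain xi.
exists (fun b xi => [set t | [/\ forall x, x < len xi -> t (s b x) = Some k0,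
   t (s b (len xi)) = Some k1 &
   forall x, x < len xi -> t (s (s b (len xi)) x) = xi x]]).
split; first split.
- move=> b xi t t' /asboolP tt' [H0 H1 H2]; split=> [x /H0/tt'//||x xl];
  first exact: tt'.
  have := H2 x xl; rewrite -lenP in xl; case: (xi x) xl => // k _; exact: tt'.
- move=> b xi xi' t [H0 H1 H2] [H0' H1' H2'].
  (* Along [s b] the first [k1] stands at the length, so [t] determines it. *)
  have El : len xi = len xi'.
    case: (ltgtP (len xi) (len xi')) => // [/H0'|/H0];
      first by rewrite H1 => -[] /esym.
    by rewrite H1' => -[] /esym.
  apply: tree_inj => x; have [xl|nx] := boolP (x < len xi).
    by rewrite -H2 // El H2' // -El.
  have := nx; rewrite El -lenP; move: nx; rewrite -lenP.
  by case: (xi x) => // _; case: (xi' x).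
(* Nothing is written in [t] from its length [b] on, so every code fits at any [b'] above [b]. *)
- move=> t; have [b tb] := tree_domain t; exists b => b' bb' xi.
  pose y := s b' (len xi).
  have tN z : b <= z -> t z = None by move=> bz; have := tb z; rewrite ltNge bz;
    case: (t z).
  have /choice[v vP] : forall z, exists k, [/\ forall k', t z = Some k' -> k = k',
      z = y -> k = k1, (exists2 x, x < len xi & z = s b' x) -> k = k0 &
      forall x k', xi x = Some k' -> z = s y x -> k = k'].
    move=> z; have [zb|bz] := ltP z b.
      have zb' := lt_le_trans zb bb'.
      have : isSome (t z) by rewrite tb.
      case E: (t z) => [k|//] _; exists k; split=> [k' []//|zy|[x _ zx]|x k' _ zx].
      - by have := s_gt b' (len xi); rewrite -/y -zy ltNge (ltW zb').
      - by have := s_gt b' x; rewrite -zx ltNge (ltW zb').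
      - by have := lt_trans (s_gt b' (len xi)) (s_gt y x);
        rewrite -zx ltNge (ltW zb').
    rewrite tN //; have [->|zy] := eqVneq z y.
      exists k1; split=> // [[x xl yx]|x k' _ yx].
        by have := s_lt b' _ _ xl; rewrite -yx ltxx.
      by have := s_gt y x; rewrite -yx ltxx.
    have [[x xl zx]|nx] := pselect (exists2 x, x < len xi & z = s b' x).
      exists k0; split=> // [/eqP|x' k' _ zx']; first by rewrite (negbTE zy).
      have := s_lt b' _ _ xl; rewrite -/y -zx zx' ltNge.
      by rewrite (ltW (s_gt y x')).
    have [[x [k' [xk' zx]]]|nx'] := pselect (exists x k',
      xi x = Some k' /\ z = s y x).
      exists k'; split=> // [/eqP|x2 k2 xk2 zx2]; first by rewrite (negbTE zy).
      have E : x2 = x.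
        case: (ltgtP x2 x) => // /(s_lt y); first by rewrite -zx -zx2 ltxx.
        by rewrite -zx -zx2 ltxx.
      by move: xk2; rewrite E xk' => -[].
    exists k0; split=> // [/eqP|x k' xk zx]; first by rewrite (negbTE zy).
    by case: nx'; exists x, k'.
  have [t' t'P] := tree_of v (s y (len xi)).
  have ys : y < s y (len xi) by exact: s_gt.
  exists t'.
    split=> [x xl||x xl].
    - rewrite t'P (lt_trans (s_lt b' _ _ xl)) //.
      by case: (vP (s b' x)) => _ _ -> //; exists x.
    - by rewrite t'P -/y ys; case: (vP y) => _ -> //.
    - rewrite -/y t'P (s_lt y _ _ xl); have : isSome (xi x) by rewrite lenP.
      case E: (xi x) => [k|//] _; by case:
        (vP (s y x)) => _ _ _ /(_ x k E erefl) ->.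
  apply/asboolP => x k tx; have xb : x < b by rewrite -tb tx.
  rewrite t'P ifT; first by case: (vP x) => /(_ _ tx) -> .
  apply: lt_trans ys; apply: lt_trans (s_gt b' _); exact: lt_le_trans bb'.
Qed.

End TreeCardinals.

(** A regular open set forces [xi] when [C a xi] is dense below each of its points, which the double
    [perp] expresses. *)
Lemma regular_open_tail_collapsing d (L : orderType d) M d' (P : porderType d')
    (C : L -> M -> set P) : tail_collapsing C ->
  exists C' : L -> M -> set (nonzero (regular_open P)), tail_collapsing C'.
Proof.
move=> [[Co Ci] Ct].
have inU (U : nonzero (regular_open P)) : exists p, ro_set (nz_val U :
  regular_open P) p.
  have /eqP U0 := nz_neq0 U; apply: contrapT => nU; apply: U0; apply/ro_inj/seteqP.
  by split=> // p Up; case: nU; exists p.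
exists (fun a xi => [set U : nonzero (regular_open P) | ro_set (nz_val U :
  regular_open P) `<=` perp (perp (C a xi))]).
split; first split.
- by move=> a xi U V; rewrite nonzero_le => /ro_leP VU /(subset_trans VU).
- move=> a xi xi' U H H'; have [p Up] := inU U.
  have dense (A : set P) q : perp (perp A) q -> exists2 r, r <= q & A r.
    move=> Aq; apply: contrapT => nA; apply: (Aq q (lexx q)) => r rq Ar.
    by apply: nA; exists r.
  have [q qp Cq] := dense _ _ (H _ Up).
  have [r rq Cr] := dense _ _ (perp_down qp (H' _ Up)).
  by apply: Ci Cr; apply: Co Cq.
- move=> U; have [p Up] := inU U; have [a aP] := Ct p; exists a => b ab xi.
  have [q Cq qp] := aP b ab xi; exists (Nonzero (ro_of_neq0 q)).
    by apply: perpS; apply: perpS => r rq; apply: Co Cq.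
  rewrite nonzero_le; apply/ro_leP; rewrite /= -(perp_perp (nz_val U)).
  by apply: perpS; apply: perpS => r rq; apply: ro_down Up; apply: le_trans qp.
Qed.

(** * The base matrix *)

(** If some segment is as large as the whole, take the least [z] with such a segment and pull the
    order back along an injection into it. *)
Lemma continuum_well_order : exists lt : continuum -> continuum -> Prop,
  [/\ well_founded lt, forall x y, x <> y -> lt x y \/ lt y x &
      forall x, ~ ([set: continuum] #<= [set y | lt y x])].
Proof.
pose lt (x y : continuum) := wo x y /\ x <> y.
have lt_wf : well_founded lt.
  move=> x; apply: contrapT => nx.
  have [|z nz zmin] := @wo_min [set y | ~ Acc lt y]; first by exists x.
  apply: nz; split=> y [yz ne]; apply: contrapT => /zmin zy.
  by apply: ne; apply: wo_anti; rewrite yz.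
have lt_trich x y : x <> y -> lt x y \/ lt y x.
  by move=> ne; case/orP: (wo_total x y) => h; [left|right]; split=> // /esym.
have [[x0 Hx0]|nx] := pselect ([set x | [set:
  continuum] #<= [set y | lt y x]] !=set0); last first.
  by exists lt; split=> // x Hx; apply: nx; exists x.
have [z Hz zmin] := wf_minimal lt_wf (ex_intro _ x0 Hx0).
have [f [fz fI]] := card_leq_inj z Hz.
exists (fun x y => lt (f x) (f y)); split=> [|x y ne|x Hx].
- move=> x; have [u E] : exists u, u = f x by exists (f x).
  elim/(well_founded_ind lt_wf): u x E => u IH x E; split=> y.
  by rewrite -E => /IH; apply.
- by apply: lt_trich => E; apply: ne; apply: fI.
apply: (zmin (f x)); first exact: fz.
apply: card_le_trans Hx _; apply: (inj_card_leq (f := f)) => // y y' _ _; exact: fI.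
Qed.

(** Recursion along an initial well-order: fewer than continuum many elements are used before [x],
    so [S x] has a fresh one. *)
Lemma disjoint_choice U (u0 : U) (G : set continuum) (S : continuum -> set U) :
  (forall x, G x -> [set: continuum] #<= S x) -> exists e : continuum -> U,
    (forall x, G x -> S x (e x)) /\ (forall x y, G x -> G y -> e x = e y -> x = y).
Proof.
move=> GS; have [lt [lt_wf lt_trich lt_init]] := continuum_well_order.
have /choice[pick pickP] : forall A : set U, exists x, A !=set0 -> A x.
  by move=> A; have [[x Ax]|A0] := pselect (A !=set0); [exists x|exists u0].
have [e eE] := wf_recursion lt_wf u0
  (fun x F => pick [set u | S x u /\ forall y, lt y x -> F y <> u]).
have eP x : G x -> S x (e x) /\ forall y, lt y x -> e y <> e x.
  move=> Gx; pose A := [set u | S x u /\ forall y, lt y x -> e y <> u].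
  have -> : e x = pick A.
    rewrite eE; congr pick; apply/seteqP.
    by split=> u [Su H]; split=> // y yx; have := H y yx; case: asboolP.
  change (A (pick A)); apply: pickP; apply: contrapT => A0; apply: (lt_init x).
  apply: card_le_trans (GS x Gx) _; apply: card_le_trans _ (card_image_le e _).
  apply: subset_card_le => u Su; apply: contrapT => nu; apply: A0; exists u.
  by split=> // y yx eu; apply: nu; exists y.
exists e; split=> [x /eP[]//|x y Gx Gy E]; apply: contrapT => /lt_trich[xy|yx].
  by have [_ /(_ x xy)] := eP y Gy.
by have [_ /(_ y yx)] := eP x Gx; rewrite E.
Qed.

Definition separative d (P : porderType d) : Prop :=
  forall p q : P, ~ p <= q -> exists2 r, r <= p & ~ compatible r q.

Section BaseMatrix.
Context {d : Order.disp_t} (P : porderType d) (D : omega1 -> set P) (i :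
  continuum -> P).
Hypothesis Pclosed : sigma_closed P.
Hypothesis Psep : separative P.
Hypothesis i_dense : forall p, exists m, i m <= p.
Hypothesis D_dense : forall a, order_dense (D a).
Hypothesis D_open : forall a, order_open (D a).
Hypothesis D_empty : forall p, exists a, ~ D a p.

(** [A a] is maximal among the conditions in [D a] lying below a member of every earlier antichain;
    these are dense because [a] has countably many predecessors. *)
Let antichains : exists A : omega1 -> set P, forall a,
  [/\ A a `<=` D a, antichain (A a), forall p, exists2 x, A a x & compatible x p &
      forall b x, b < a -> A a x -> exists2 y, A b y & x <= y].
Proof.
have /choice[mac macP] : forall S : set P, exists A, [/\ A `<=` S, antichain A &
    forall s, S s -> exists2 x, A x & compatible x s].
  by move=> S; have [//|//|A [_ ? ? ?]] := @maximal_antichain _ P S set0; exists A.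
have [A AE] := wf_recursion omega1_wf (set0 : set P)
  (fun a F => mac [set q | D a q /\ forall b, b < a -> exists2 y, F b y & q <= y]).
exists A; pose E a := [set q | D a q /\ forall b, b < a -> exists2 y,
  A b y & q <= y].
have {}AE a : A a = mac (E a).
  rewrite AE; congr mac; apply/seteqP.
  by split=> q [Dq H]; split=> // b ba; have := H b ba; case: asboolP.
move=> a; suff E_dense : order_dense (E a).
  have [AS Aa Amax] := macP (E a); rewrite -AE in AS Aa Amax; split=> //.
  - by move=> x /AS[].
  - move=> p; have [q Eq qp] := E_dense p; have [x Ax c] := Amax _ Eq.
    by exists x => //; apply: compatible_le c.
  - by move=> b x ba /AS[_]; apply.
elim/(well_founded_ind omega1_wf): a => a IH p.
have [q0 Dq0 q0p] := D_dense a p.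
have [|q Eq qq0] := @sigma_distributive _ P Pclosed _ [set b | b < a]
    (fun b => [set q | exists2 y, A b y & q <= y]) (omega1_lt_countable a) _ q0.
  move=> b ba; split=> [x|x y yx [z Az xz]]; last by exists z => //;
    apply: le_trans xz.
  have [q Eq qx] := IH b ba x; have [_ _ /(_ _ Eq)] := macP (E b).
  by rewrite -AE => -[y Ay [r ry rq]]; exists r; [exists y|apply: le_trans qx].
exists q; last exact: le_trans q0p.
by split=> [|b /Eq//]; apply: D_open Dq0.
Qed.

Let A := projT1 (cid antichains).
Let AP a : [/\ A a `<=` D a, antichain (A a), forall p, exists2 x,
  A a x & compatible x p &
      forall b x, b < a -> A a x -> exists2 y, A b y & x <= y].
Proof. exact: (projT2 (cid antichains)). Qed.

(** Some [D a] omits [p], so [p] is not below the member [x0] that it meets; by separativity a part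
    of [p] is incompatible with [x0] and meets another member. *)
Let split p : exists a x0 x1 p0 p1,
  [/\ A a x0 /\ A a x1, x0 <> x1, p0 <= x0 /\ p0 <= p & p1 <= x1 /\ p1 <= p].
Proof.
have [a nDp] := D_empty p; have [AD Aa Amax _] := AP a.
have [x0 Ax0 [p0 px0 pp0]] := Amax p.
have [|r rp nr] := Psep (p := p) (q := x0).
  by move=> px; apply: nDp; apply: D_open px (AD _ Ax0).
have [x1 Ax1 [p1 px1 pp1]] := Amax r.
exists a, x0, x1, p0, p1; split=> //; last by split=> //; apply: le_trans rp.
by move=> E; apply: nr; exists p1 => //; rewrite E.
Qed.

(** Iterated splitting builds a binary tree below [p], whose countably many splitting levels have a
    bound [a]. Each branch has a lower bound meeting a member of [A a]; as [A a] refines the earlier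
    antichains, members chosen for distinct branches differ. *)
Let splitting p : exists a, [set: continuum] #<= [set x | A a x /\ compatible x p].
Proof.
have /choice[sa saP] := split.
have /choice[sx0 {}saP] := saP; have /choice[sx1 {}saP] := saP.
have /choice[sp0 {}saP] := saP; have /choice[sp1 {}saP] := saP.
pose sx q (b : bool) := if b then sx1 q else sx0 q.
pose sp q (b : bool) := if b then sp1 q else sp0 q.
have spx q b : sp q b <= sx q b by case: b; have [_ _ [? ?] [? ?]] := saP q.
have spq q b : sp q b <= q by case: b; have [_ _ [? ?] [? ?]] := saP q.
have sxA q b : A (sa q) (sx q b) by case: b; have [[? ?] _ _ _] := saP q.
have sxI q b c : sx q b = sx q c -> b = c.
  by have [_ ne _ _] := saP q; case: b; case: c => // /esym.
pose node s := foldl sp p s.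
have [a aP] := omega1_bounded
  (fun n => if choice.unpickle n is Some s then sa (node s) else sa p).
have {}aP s : sa (node s) < a by have := aP (choice.pickle s);
  rewrite choice.pickleK.
exists a.
have /choice[e eP] : forall f : continuum, exists x, A a x /\
    exists2 q, q <= x & forall n, q <= node (map f (iota 0 n)).
  move=> f; have [n|q qn] := Pclosed (u := fun n => node (map f (iota 0 n))).
    by rewrite -addn1 iotaD map_cat /node foldl_cat /=; apply: spq.
  have [_ _ /(_ q)[x Ax [r rx rq]] _] := AP a; exists x; split=> //.
  by exists r => // n; apply: le_trans (qn n).
apply: (inj_card_leq (f := e)) => [f _|f g _ _ E].
  have [Ax [q qx qn]] := eP f; split=> //; exists q => //; exact: (qn 0%N).
apply/funext => n; elim/ltn_ind: n => n IH.
pose s := map f (iota 0 n).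
have sg : s = map g (iota 0 n).
  by apply/eq_in_map => k; rewrite mem_iota => /andP[_ kn]; apply: IH.
have [Af [q qx qn]] := eP f; have [Ag [r rx rn]] := eP g; rewrite -E in Ag rx.
have qs : q <= sx (node s) (f n).
  apply: le_trans (qn n.+1) _; rewrite -addn1 iotaD map_cat /node foldl_cat /=
    add0n; exact: spx.
have rs : r <= sx (node s) (g n).
  apply: le_trans (rn n.+1) _; rewrite -addn1 iotaD map_cat /node foldl_cat /=
    add0n -sg; exact: spx.
have [_ _ _ /(_ _ _ (aP s) Af)[y Ay xy]] := AP a.
have [_ Aa _ _] := AP (sa (node s)).
apply: (sxI (node s)); transitivity y.
  by apply: Aa => //; exists q => //; apply: le_trans xy.
by apply: Aa => //; exists r => //; apply: le_trans xy.
Qed.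

(** At level [a], each pair of a value [g] and an [x] whose [i x] meets continuum many members
    receives its own member of [A a] compatible with [i x]. Conditions below that member force the
    value [g]. *)
Lemma base_matrix : exists C : omega1 -> continuum -> set P, collapsing C.
Proof.
pose l (z : continuum) n := z n.*2; pose r (z : continuum) n := z n.*2.+1.
pose enc (x y : continuum) n := if odd n then y n./2 else x n./2.
have lK x y : l (enc x y) = x by apply/funext => n;
  rewrite /l /enc odd_double doubleK.
have rK x y : r (enc x y) = y.
  by apply/funext => n; rewrite /r /enc /= odd_double /= uphalf_double.
pose S a x := [set y | A a y /\ compatible y (i x)].
have /choice[e eP] : forall a, exists e : continuum -> P,
    (forall z, [set: continuum] #<= S a (l z) -> S a (l z) (e z)) /\
    (forall z z', [set: continuum] #<= S a (l z) -> [set: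
      continuum] #<= S a (l z') ->
       e z = e z' -> z = z').
  move=> a; have [//|e eP] := @disjoint_choice _ (i (fun=> true))
    [set z | [set: continuum] #<= S a (l z)] (fun z => S a (l z)).
  by exists e.
exists (fun a g => [set q | exists x, [set:
  continuum] #<= S a x /\ q <= e a (enc x g)]).
split; first split.
- by move=> a g p q qp [x [Sx px]]; exists x; split=> //; apply: le_trans px.
- move=> a g g' p [x [Sx px]] [x' [Sx' px']].
  have [eS eI] := eP a; have [_ Aa _ _] := AP a.
  have := eI (enc x g) (enc x' g'); rewrite !lK => /(_ Sx Sx') H.
  have Ae y h : [set: continuum] #<= S a y -> A a (e a (enc y h)).
    by move=> Sy; have := eS (enc y h); rewrite lK => /(_ Sy)[].
  by rewrite -(rK x g) H ?rK //; apply: Aa; [exact: Ae|exact: Ae|exists p].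
move=> p; have [x xp] := i_dense p; have [a Sx] := splitting (i x).
exists a => g; have [+ _] := eP a; move=> /(_ (enc x g));
  rewrite lK => /(_ Sx)[_ [q qe qx]].
by exists q; [exists x|apply: le_trans xp].
Qed.

End BaseMatrix.

(** * The algebra P(omega)/Fin *)

Section PomegaFin.

Local Notation pi A := (ba_pi forcing_display fin_congr A : Pomega_fin).

Lemma finite_natP (A : set nat) :
  finite_set A <-> exists N, forall n, (N <= n)%N -> ~ A n.
Proof.
split=> [/finite_seqP[s ->]|[N AN]].
  exists (\max_(n <- s) n).+1 => n; rewrite ltnNge => /negP nn /= sn; apply: nn.
  exact: leq_bigmax_seq.
apply: sub_finite_set (finite_II N) => n An /=; rewrite ltnNge; apply/negP => /AN;
  exact.
Qed.

Lemma pi_leP A B : pi A <= pi B <-> almost_sub A B.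
Proof.
rewrite Pomega_fin_le; split=> [/asboolP/finite_natP[N H]|[N H]].
  by exists N => n /H nAB An; apply: contrapT => nB; apply: nAB.
by apply/asboolP/finite_natP; exists N => n /H AB [/AB].
Qed.

Lemma pi_neq0P A : pi A != \bot <-> unbounded A.
Proof.
have pi0 : pi A = \bot <-> almost_sub A set0.
  rewrite -pi_leP; split=> [->|H]; first exact: lexx.
  by apply/eqP; rewrite -lex0.
split=> [/eqP nA N|HA].
  apply: contrapT => nN; apply: nA; apply/pi0; exists N => n Nn An.
  by apply: nN; exists n.
by apply/eqP => /pi0[N H]; have [n Nn /(H _ Nn)] := HA N.
Qed.

Lemma pi_surj (x : Pomega_fin) : exists A, x = pi A.
Proof. by elim/ba_quotW: x => A; exists A. Qed.

(** [Pomega_fin] is isomorphic to the reduced power of [bool]. *)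
Lemma Pomega_fin_sigma_closed : sigma_closed (nonzero Pomega_fin).
Proof.
move=> u uS.
have /choice[A AP] : forall n, exists A, (u n : Pomega_fin) = pi A by move=> n;
  exact: pi_surj.
have v0 n : (ba_pi _ (frechet_congr bool) (fun k => `[< A n k >]) :
  rp bool) != \bot.
  apply/rp_neq0P => N; have /pi_neq0P /(_ N)[k Nk Ak] : pi (A n) != \bot.
    by rewrite -AP; exact: nz_neq0.
  by exists k => //=; rewrite asboolT.
have [|q qv] := @rp_sigma_closed _ bool (fun n => Nonzero (v0 n)).
  move=> n; rewrite nonzero_le /=; apply/rp_leP.
  have /pi_leP[N AN] : pi (A n.+1) <= pi (A n) by rewrite -!AP; exact: uS.
  exists N => k /AN H; have [Ak|nA] := pselect (A n.+1 k).
    by rewrite (asboolT (H Ak)) lex1.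
  by rewrite (asboolF nA) le0x.
have [b qb] := rp_surj q.
have b0 : pi [set k | b k] != \bot.
  apply/pi_neq0P => N; have /rp_neq0P /(_ N)[k Nk bk] :
    (ba_pi _ (frechet_congr bool) b : rp bool) != \bot.
    by rewrite -qb; exact: nz_neq0.
  by exists k => //=; move: bk => /=; case: (b k) => // /eqP.
exists (Nonzero b0) => n; rewrite nonzero_le /= AP; apply/pi_leP.
have := qv n; rewrite nonzero_le /= qb => /rp_leP[N bN]; exists N => k /bN /=.
by case: (b k) => //; case: asboolP.
Qed.

Lemma Pomega_fin_dense : exists i : continuum -> nonzero Pomega_fin,
  forall p, exists f, i f <= p.
Proof.
have T0 : pi setT != \bot by apply/pi_neq0P => N; exists N.
exists (fun f => if pselect (pi [set n | f n] != \bot) is left h then Nonzero h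
  else Nonzero T0).
move=> p; have [A pA] := pi_surj p; exists (fun n => `[< A n >]).
have -> : [set n | `[< A n >]] = A by apply/seteqP; split=> n /asboolP.
case: pselect => [h|]; first by rewrite nonzero_le /= pA.
by rewrite -pA; case; exact: nz_neq0.
Qed.

Lemma nonzero_separative d (B : ctbDistrLatticeType d) : separative (nonzero B).
Proof.
move=> p q npq; have r0 : (p : B) `\` (q : B) != \bot by rewrite diff_eq0;
  apply/negP.
exists (Nonzero r0); first by rewrite nonzero_le /= leBx.
case=> s; rewrite !nonzero_le /= => sr sq; have /negP := nz_neq0 s; apply.
by rewrite -lex0 -(diffKI (p : B) (q : B)) lexI sr sq.
Qed.

(** The dense open sets witnessing [h] have no common element below some [p0]. Pulling them back
    along an injection of [nat] into a representative of [p0] leaves no common element at all, as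
    [base_matrix] requires. *)
Lemma h_collapsing : (exists2 F, is_h F & F #= [set: omega1]) ->
  exists C : omega1 -> continuum -> set (nonzero Pomega_fin), collapsing C.
Proof.
case=> F [[FD nF] _] Fo1.
rewrite card_eq_sym in Fo1; have [D0 [D0F _ D0S]] :=
  card_eq_bij (set0 : set (nonzero Pomega_fin)) Fo1.
have [p0 p0P] : exists p0, forall q, (\bigcap_(D in F) D) q -> ~ q <= p0.
  apply: contrapT => np; apply: nF => p; apply: contrapT => nq; apply: np.
  by exists p => q Fq qp; apply: nq; exists q.
have [A0 p0A] := pi_surj p0.
have A0inf : unbounded A0 by apply/pi_neq0P; rewrite -p0A; exact: nz_neq0.
have [|j [_ jS]] := @dependent_choice nat (fun m n => (m < n)%N /\ A0 n) 0%N.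
  by move=> m; have [n mn A0n] := A0inf m.+1; exists n.
(* The start [j 0] is [0], which need not lie in [A0]. *)
pose k n := j n.+1.
have kA0 n : A0 (k n) by case: (jS n).
have klt : {homo k : m n / (m < n)%N}.
  by apply: homo_ltn => [x y z|n]; [exact: ltn_trans|case: (jS n.+1)].
have kge n : (n <= k n)%N by elim: n => // n /leq_ltn_trans; apply; exact: klt.
have kinj : injective k.
  by move=> m n E; case: (ltngtP m n) => // /klt; rewrite E ltnn.
have kle N n : (k N <= k n)%N -> (N <= n)%N.
  by rewrite leqNgt => /negP H; rewrite leqNgt; apply/negP => /klt.
have img_sub B B' : almost_sub B B' -> almost_sub (k @` B) (k @` B').
  move=> [N H]; exists (k N) => m Nm [n Bn E]; exists n => //.
  by apply: H Bn; apply: kle; rewrite E.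
have img_inf B : unbounded B -> unbounded (k @` B).
  by move=> HB N; have [n Nn Bn] := HB N; exists (k n);
    [exact: leq_trans (kge n)|exists n].
have /choice[J JP] : forall p : nonzero Pomega_fin, exists q : nonzero Pomega_fin,
    exists B, (p : Pomega_fin) = pi B /\ (q : Pomega_fin) = pi (k @` B).
  move=> p; have [B pB] := pi_surj p.
  have q0 : pi (k @` B) != \bot.
    by apply/pi_neq0P/img_inf/pi_neq0P; rewrite -pB; exact: nz_neq0.
  by exists (Nonzero q0), B.
have J_le (p : nonzero Pomega_fin) B : (p : Pomega_fin) <= pi B -> (J p :
  Pomega_fin) <= pi (k @` B).
  by have [B' [-> ->]] := JP p => /pi_leP/img_sub/pi_leP.
have [i i_dense] := Pomega_fin_dense.
apply: (@base_matrix _ (nonzero Pomega_fin) (fun a => [set q | D0 a (J q)]) i) =>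
  //.
- exact: Pomega_fin_sigma_closed.
- exact: nonzero_separative.
- move=> a p; have [r Dr rJ] := (FD _ (D0F a I)).1 (J p).
  have [B [pB JB]] := JP p; have [R rR] := pi_surj r.
  have [N RB] : almost_sub R (k @` B) by apply/pi_leP; rewrite -rR -JB.
  have Rinf : unbounded R by apply/pi_neq0P; rewrite -rR; exact: nz_neq0.
  (* [R] lies almost inside the range of [k], so its preimage is a condition that [J] carries below
     [R]. *)
  have B'0 : pi (k @^-1` R) != \bot.
    apply/pi_neq0P => n; have [m nm Rm] := Rinf (maxn N (k n)).
    move: nm; rewrite geq_max => /andP[Nm knm].
    have [x _ E] := RB m Nm Rm; exists x; first by apply: kle; rewrite E.
    by rewrite /= E.
  exists (Nonzero B'0).
    apply: (FD _ (D0F a I)).2 Dr; rewrite nonzero_le rR.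
    apply: (le_trans (J_le _ (k @^-1` R) _)); first by rewrite /=.
    by apply/pi_leP; exists 0%N => m _ [n Rn <-].
  rewrite nonzero_le pB; apply/pi_leP; exists N => n Nn /= Rn.
  by have [n' Bn' /kinj <-] := RB _ (leq_trans Nn (kge n)) Rn.
- move=> a p q qp; apply: (FD _ (D0F a I)).2.
  have [B [pB JB]] := JP p.
  by rewrite nonzero_le JB; apply: J_le; rewrite -pB.
- move=> p; apply: contrapT => np; apply: (p0P (J p)).
    move=> D FDD; have [a _ <-] := D0S D FDD.
    by apply: contrapT => nD; apply: np; exists a.
  have [B [_ JB]] := JP p.
  by rewrite nonzero_le JB p0A; apply/pi_leP; exists 0%N => m _ [n _ <-].
Qed.

End PomegaFin.

(** * Iterated reduced powers *)

Lemma rpn_collapse d (B : ctbDistrLatticeType d) (M : Type) (s : M -> nat -> M)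
    (p0 : nonzero B) (i : M -> nonzero B) (C :
      omega1 -> M -> set (nonzero (rp B))) :
  (exists m0 m1 : M, m0 <> m1) -> (forall f, exists m, s m = f) ->
  (forall p, exists m, i m <= p) -> collapsing C ->
  forall n, (0 < n)%N -> ro (rpn n B) ≅ Col omega1 M.
Proof.
move=> M2 sS iD CC.
(* The name is carried one power ahead, because sigma-closure is available only from the first power
   on. *)
suff H n : (exists p : nonzero (rpn n B), True) /\
    (exists i : M -> nonzero (rpn n B), forall p, exists m, i m <= p) /\
    (exists C : omega1 -> M -> set (nonzero (rpn n.+1 B)), collapsing C).
  case=> // n _; have [_ [_ [C' C'P]]] := H n; have [[p _] [[i' i'P] _]] := H n.+1.
  exact: (collapse_iso p (@rp_sigma_closed _ (rpn n B)) i'P C'P).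
elim: n => [|n [[p _] [[i' i'D] [C' C'P]]]].
  by split; [exists p0|split; [exists i|exists C]].
have [i2 i2D] := rp_dense p M2 sS i'D.
have [m _] := M2; have p2 := i2 m.
split; first by exists p2.
split; first by exists i2.
have [C2 C2P] := tail_collapsing_nodes p2 (@rp_sigma_closed _ (rpn n B)) i2D C'P.
(* The tree has height [omega1], so each index names itself. *)
apply: (@rp_collapsing _ (rpn n.+1 B) _ omega1 M C2 (fun a g _ => g = a)) => //.
- exact: omega1_bounded.
- by move=> a g g' S _ -> ->.
- by move=> S g0 S0; exists g0, g0; split=> //; exists S; split.
Qed.

Lemma cofinality_bounded d (L : orderType d) (A : set L) :
  (forall x : L, exists y, x < y) -> is_cf A -> [set: omega1] #<= A ->
  forall u : nat -> L, exists a, forall n, u n < a.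
Proof.
move=> Lsucc [_ Amin] oA u; apply: contrapT => nu.
apply: omega1_uncountable; apply: sub_countable (card_le_trans oA (Amin (range u)
  _)) _.
  move=> x; apply: contrapT => nx; apply: nu; have [y xy] := Lsucc x; exists x => n.
  by rewrite ltNge; apply/negP => xu; apply: nx; exists (u n) => //; exists n.
exact: card_image_le.
Qed.

(** With a largest element [x], [L] is the infinite segment before [x] plus one point, which that
    segment absorbs. *)
Lemma cardinal_no_max d (L : orderType d) :
  is_cardinal L -> [set: nat] #<= [set: L] -> forall x : L, exists y, x < y.
Proof.
move=> [Lwf Lcard] Linf x; apply: contrapT => nx.
have xmax y : y <= x by rewrite leNgt; apply/negP => xy; apply: nx; exists y.
have [f [fL fI]] : exists f : nat -> L, (forall n, [set: nat] n -> [set: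
  L] (f n)) /\
   forall m n, [set: nat] m -> [set: nat] n -> f m = f n -> m = n.
  exact: card_leq_inj.
have inf : infinite_set [set y | y < x].
  move=> fin; have : finite_set [set: L].
    rewrite (_ : [set: L] = [set y | y < x] `|` [set x]);
      first by rewrite finite_setU; split.
    apply/seteqP; split=> // y _ /=; have := xmax y; rewrite le_eqVlt.
    by case/orP => [/eqP|]; [right|left].
  by apply/infiniteP.
have [g [gx gI]] := infinite_absorb inf.
have [z /= zx] := infinite_setN0 inf.
apply: (Lcard x); apply: (inj_card_leq (f :=
  fun y => if y < x then g 0%N y else g 1%N z)).
  by move=> y _; case: ifP => yx; apply: gx.
move=> y y' _ _; case: ltP => yx; case: ltP => yx' E.
- by have [] := gI _ _ _ _ yx yx' E.
- by have [] := gI _ _ _ _ yx zx E.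
- by have [] := gI _ _ _ _ zx yx' E.
- by apply: le_anti; rewrite (le_trans (xmax y) yx') (le_trans (xmax y') yx).
Qed.

(** * Iterated powers of collapsing algebras *)

Section Assembly.
Context {d : Order.disp_t} (L : orderType d) (K : Type) (l0 : L) (k0 k1 : K).
Hypothesis Lcard : is_cardinal L.
Hypothesis Lbounded : forall u : nat -> L, exists a, forall n, u n < a.
Hypothesis k01 : k0 <> k1.

(** The bijection [h] allows [tree L K] itself or another set of that size, such as the continuum,
    as the set of values. *)
Lemma rpn_Col_collapse (M : Type) (h : M -> tree L K) (E :
  omega1 -> L -> set (set nat)) :
  bijective h ->
  (forall a g S T, almost_sub T S -> E a g S -> E a g T) ->
  (forall a g g' S, unbounded S -> E a g S -> E a g' S -> g = g') ->
  (forall S g0, unbounded S -> exists a g, g0 <= g /\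
     exists T, [/\ unbounded T, T `<=` S & E a g T]) ->
  forall n, (0 < n)%N -> ro (rpn n (Col L K)) ≅ Col omega1 M.
Proof.
move=> [h' hK h'K] Eo Ei Ed.
have [s sS] := tree_sequences l0 Lbounded k01.
have [C0 C0P] := tree_tail_collapsing l0 Lbounded k01 Lcard.
have [C1 [[C1o C1i] C1t]] := regular_open_tail_collapsing C0P.
have C1P : tail_collapsing (fun a m => C1 a (h m)).
  split; first by split=> [a m|a m m' p];
    [exact: C1o|move=> /C1i H /H /(can_inj hK)].
  by move=> p; have [a aP] := C1t p; exists a => b ab m; apply: aP.
have [C2 C2P] := rp_collapsing Lbounded C1P Eo Ei Ed.
have [a /(_ 0%N) l0a] := Lbounded (fun=> l0).
have [t0 t0P] := tree_of (fun=> k0) a; have [t1 t1P] := tree_of (fun=> k1) a.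
have t01 : t0 <> t1 by move=> E01; have := t0P l0; rewrite E01 t1P l0a => -[] /esym.
pose i m : nonzero (Col L K) := Nonzero (ro_of_neq0 (h m)).
apply: (rpn_collapse (s := fun m n => h' (s (h m) n)) (i (h' t0)) (i :=
  i) _ _ _ C2P).
- by exists (h' t0), (h' t1) => /(can_inj h'K).
- move=> f; have [t tf] := sS (h \o f); exists (h' t); apply/funext => n.
  by rewrite h'K tf /= hK.
- move=> U; have [t tU] := ro_of_dense (nz_neq0 U); exists (h' t).
  by rewrite nonzero_le /= h'K.
Qed.

End Assembly.

(** A real is written along an [omega]-sequence [u] inside one node; conversely a node is coded by
    its length, a real through [o1_val], and its countably many values. *)
Lemma tree_omega1_continuum (K : Type) (k0 k1 : K) (a0 : omega1) : k0 <> k1 ->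
  [set: K] #<= [set: continuum] -> exists h :
    continuum -> tree omega1 K, bijective h.
Proof.
move=> k01 Kc.
suff /(card_eq_bij (projT1 (cid (tree_of (fun=> k0) a0))))[h [_ hI hS]] :
    [set: continuum] #= [set: tree omega1 K].
  have /choice[g gK] : forall t, exists x, h x = t.
    by move=> t; have [x _ xt] := hS t I; exists x.
  by exists h, g => // x; apply: hI => //; rewrite gK.
rewrite card_eq_le; apply/andP; split.
  have [c /(_ c (lexx c)) /infiniteP cinf] := infinite_segment a0 omega1_bounded.
  have [u [uc uI]] := card_leq_inj a0 cinf.
  have /choice[e eP] : forall x : continuum, exists t : tree omega1 K,
      forall n, t (u n) = Some (if x n then k1 else k0).
    move=> x; have [t tP] := tree_of (fun z => if `[< exists2 n,
      u n = z & x n >] then k1 else k0) c.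
    exists t => n; rewrite tP ifT; last exact: uc.
    congr Some; case: asboolP => [[m um xm]|]; first by rewrite -(uI _ _ I I um) xm.
    by case xn: (x n) => // -[]; exists n.
  apply: (inj_card_leq (f := e)) => // x y _ _ E; apply/funext => n.
  have := eP x n; rewrite E eP => -[]; case: (x n); case: (y n) => // H.
  by case: k01.
have [f [_ fI]] := card_leq_inj (fun=> true : bool) Kc.
have /choice[e eP] : forall a : omega1, exists e : omega1 -> nat,
    {in [set b | b < a] &, injective e}.
  by move=> a; apply/countable_injP/omega1_lt_countable.
(* Row [0] of [z] holds the length [a], and row [e a x + 1] the value at [x]. *)
have /choice[c cP] : forall t : tree omega1 K, exists z : continuum, exists a,
    [/\ forall x, isSome (t x) = (x < a),
        forall m, z (choice.pickle (0%N, m)) = o1_val a m &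
        forall x k m, x < a -> t x = Some k -> z (choice.pickle ((e a x).+1,
          m)) = f k m].
  move=> t; have [a aP] := tree_domain t.
  have /choice[v vP] : forall n, exists z :
    continuum, forall x k, x < a -> e a x = n -> t x = Some k -> z = f k.
    move=> n; have [[x xa xn]|nx] := pselect (exists2 x, x < a & e a x = n);
      last first.
      by exists (fun=> true) => x k xa xn; case: nx; exists x.
    have : isSome (t x) by rewrite aP.
    case E: (t x) => [k|//] _; exists (f k) => y k' ya yn tk.
    have xy : x = y by apply: (eP a); rewrite ?inE ?xn.
    by move: tk; rewrite -xy E => -[->].
  exists (fun n => if choice.unpickle n is Some (i, m) then
                     if i is i'.+1 then v i' m else o1_val a m else true), a.
  split=> // [m|x k m xa tk]; rewrite choice.pickleK //.
  by rewrite (vP _ x k).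
apply: (inj_card_leq (f := c)) => // t t' _ _ E.
have [a [aD a0E aP]] := cP t; have [a' [aD' a0E' aP']] := cP t'.
have aa' : a = a'.
  by apply: val_inj; apply/funext => m; rewrite -[LHS]a0E E a0E'.
subst a'; apply: tree_inj => x; have [xa|nx] := boolP (x < a); last first.
  by have := nx; rewrite -aD'; move: nx; rewrite -aD; case: (t x) => //;
    case: (t' x).
have : isSome (t x) by rewrite aD.
have : isSome (t' x) by rewrite aD'.
case Et' : (t' x) => [k'|//] _; case Et : (t x) => [k|//] _; congr Some.
by apply: fI => //; apply/funext => m; rewrite -(aP x k m) // E (aP' x k' m).
Qed.

Lemma card_leq_inhabited T U (A : set T) (B : set U) x : A x -> A #<= B -> B !=set0.
Proof.
move=> Ax AB; have [//|B0] := pselect (B !=set0); move: AB.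
have -> : B = set0 by apply/seteqP; split=> // y By; apply: B0; exists y.
by rewrite card_le0 => /eqP A0; rewrite A0 in Ax.
Qed.

Theorem theorem5p4 (d : Order.disp_t) (L : orderType d) (K : Type)
    (Lcard : is_cardinal L)
    (Linf : [set: nat] #<= [set: L])
    (Kge2 : [set: bool] #<= [set: K])
    (KLunc : ~ countable [set: K * L]) :
  (((exists2 A : set L, is_cf A & A #= [set: omega1]) \/
    (exists2 F, is_h F & F #= [set: omega1]) /\
    (exists2 A : set L, is_cf A &
       [set: omega1] #<= A /\ A #<= [set: continuum])) ->
   forall n : nat, (0 < n)%N ->
     ro (rpn n (Col L K)) ≅ Col omega1 (tree L K)) /\
  ((exists2 F, is_h F & F #= [set: omega1]) ->
   [set: K] #<= [set: continuum] ->
   forall n : nat, (0 < n)%N ->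
     [/\ ro (rpn n (Col omega1 K)) ≅ Col omega1 continuum,
         Col omega1 continuum ≅ ro Pomega_fin &
         ro Pomega_fin ≅ ro (rpn n Pomega_fin)]).
Proof.
have [l0 _] := card_leq_inhabited (x := 0%N) I Linf.
have [k _] := card_leq_inhabited (x := true) I Kge2.
have [kb [_ kbI]] := card_leq_inj k Kge2.
have k01 : kb false <> kb true by move=> /kbI => /(_ I I).
have Lsucc := cardinal_no_max Lcard Linf.
have idb T : bijective (@id T) by exists id.
split=> [[[A Acf Ao1]|[hC [A Acf [oA Ac]]]]|hC Kc n n0].
- rewrite card_eq_sym in Ao1.
  have Lb : forall u : nat -> L, exists a, forall n, u n < a.
    by apply: (cofinality_bounded Lsucc Acf); move: Ao1;
      rewrite card_eq_le => /andP[].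
  have [g [gA gI gS]] := card_eq_bij l0 Ao1.
  (* The cofinal set is enumerated by [omega1], so [a] names [g a] outright. *)
  apply: (rpn_Col_collapse l0 Lcard Lb k01 (E :=
    fun a l _ => l = g a) (idb _)) => //.
    by move=> a l l' _ _ -> ->.
  move=> S l S0; have [l' /gS[a _ <-] ll'] := Acf.1 l.
  by exists a, (g a); split=> //; exists S; split.
- have Lb := cofinality_bounded Lsucc Acf oA.
  have [C [[Co Ci] Cc]] := h_collapsing hC.
  have [f [_ fI]] := card_leq_inj (fun=> true : bool) Ac.
  (* [f] codes the elements of the cofinal set [A] by reals, and [a] names the one whose code [S]
     forces under [C]. *)
  apply: (rpn_Col_collapse l0 Lcard Lb k01 (idb _)
    (E := fun a l S => A l /\ forall h : (ba_pi _ fin_congr S :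
      Pomega_fin) != \bot, C a (f l) (Nonzero h))).
  + move=> a l S T TS [Al CS]; split=> // hT.
    have hS : (ba_pi _ fin_congr S : Pomega_fin) != \bot.
      apply/pi_neq0P => N; have [N' TS'] := TS;
        have /pi_neq0P /(_ (maxn N N'))[m] := hT.
      by rewrite geq_max => /andP[Nm N'm] /(TS' _ N'm); exists m.
    by apply: Co (CS hS); rewrite nonzero_le; apply/pi_leP.
  + move=> a l l' S S0 [Al CS] [Al' CS']; apply: fI => //.
    have hS : (ba_pi _ fin_congr S : Pomega_fin) != \bot by apply/pi_neq0P.
    exact: Ci (CS hS) (CS' hS).
  + move=> S l S0; have hS : (ba_pi _ fin_congr S :
    Pomega_fin) != \bot by apply/pi_neq0P.
    have [l' Al' ll'] := Acf.1 l; have [a aP] := Cc (Nonzero hS).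
    have [q Cq qS] := aP (f l'); exists a, l'; split=> //.
    have [T qT] := pi_surj q.
    have /pi_leP [N TS] : (ba_pi _ fin_congr T :
      Pomega_fin) <= ba_pi _ fin_congr S by rewrite -qT.
    have T0 : unbounded T by apply/pi_neq0P; rewrite -qT; exact: nz_neq0.
    exists (T `&` S); split.
    * move=> m; have [x] := T0 (maxn N m); rewrite geq_max => /andP[Nx mx] Tx.
      by exists x => //; split=> //; apply: TS.
    * by move=> x [].
    * split=> // h; apply: Co Cq; rewrite nonzero_le qT; apply/pi_leP.
      by exists 0%N => x _ [].
have [b _] : [set: omega1] !=set0.
  apply: contrapT => o0; apply: omega1_uncountable.
  have -> : [set: omega1] = set0 by apply/seteqP; split=> // y oy; apply: o0;
    exists y.
  exact: countable0.
have [C CP] := h_collapsing hC; have [i iD] := Pomega_fin_dense.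
have Pc := Pomega_fin_sigma_closed.
pose p0 := i (fun=> true).
have PC := collapse_iso p0 Pc iD CP.
split.
- have [h hb] := tree_omega1_continuum b k01 Kc.
  apply: (rpn_Col_collapse b omega1_is_cardinal omega1_bounded k01 (E :=
    fun a l _ => l = a) hb) => //.
    by move=> a l l' _ _ -> ->.
  by move=> S l S0; exists l, l; split=> //; exists S; split.
- exact: ba_iso_sym.
(* Both sides are isomorphic to [Col omega1 continuum]; for the powers, the nodes in [Pomega_fin]
   supply the tail name. *)
apply: ba_iso_trans PC _; apply: ba_iso_sym.
have [C1 C1P] := tail_collapsing_nodes p0 Pc iD CP.
have [|||C2 C2P] := @rp_collapsing _ Pomega_fin _ omega1 continuum C1 (fun a g _ =>
  g = a) omega1_bounded C1P => //.
- by move=> a l l' S _ -> ->.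
- by move=> S l S0; exists l, l; split=> //; exists S; split.
apply: (rpn_collapse (s := fun x n m => x (choice.pickle (n,
  m))) p0 _ _ iD C2P) => //.
- by exists (fun=> true), (fun=> false) => /(congr1 (fun f => f 0%N)).
- move=> f; exists (fun k => if choice.unpickle k is Some nm then f nm.1 nm.2 else
  true).
  by apply/funext => m; apply/funext => x; rewrite choice.pickleK.
Qed.
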